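(* In $\mathbb R^2$, for $d>1$ and $\varepsilon\in(0,1/2)$, let $\nu_0$ be the uniform probability measure on $\bigcup_{i=1}^4B(p_i,1)$ with $p_1=(1,1)$, $p_2=(1,-1)$, $p_3=(-1,-1)$, $p_4=(-1,1)$; let $\nu_1^1$ be the uniform probability measure on $B((d,0),\varepsilon)\cup B((-d,0),\varepsilon)$ and $\nu_1^2$ the uniform probability measure on $B((0,d),\varepsilon)\cup B((0,-d),\varepsilon)$. Then, for $t$ and $d$ sufficiently large and $\varepsilon$ sufficiently small, the signed Wasserstein barycenter problem $$\inf_{\mu\in\mathcal P_2(\mathbb R^2)}\Big\{t\Big(\tfrac12\tfrac{W_2^2(\mu,\nu_1^1)}{2}+\tfrac12\tfrac{W_2^2(\mu,\nu_1^2)}{2}\Big)-(t-1)\tfrac{W_2^2(\mu,\nu_0)}{2}\Big\}$$ has no minimizer that is invariant under the rotation by $\pi/2$ around the origin. Consequently its minimizer is not unique, and the set of its minimizers is not convex (with respect to linear interpolation of measures), although $\nu_0,\nu_1^1,\nu_1^2$ are all absolutely continuous.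
   Context: $\mathcal P_2(\mathbb R^2)$ is the set of Borel probability measures on $\mathbb R^2$ with finite second moment, $W_2$ is the 2-Wasserstein distance and $B(p,r)$ is the disc of center $p$ and radius $r$. The problem is known to admit at least one minimizer. *)

(* Defs.v *)
From HB Require Import structures.
From mathcomp Require Import all_boot all_order all_algebra.
From mathcomp Require Import all_classical all_reals all_analysis measurable_realfun.

Set Implicit Arguments.
Unset Strict Implicit.
Unset Printing Implicit Defensive.

Import Order.TTheory GRing.Theory Num.Theory.
Import numFieldNormedType.Exports.

Local Open Scope classical_set_scope.
Local Open Scope ring_scope.

(* The product sigma-algebra on R * R is the Borel sigma-algebra of the
   plane. *)
Definition plane (R : realType) : measurableType _ :=
  (measurableTypeR R * measurableTypeR R)%type.

Definition area (R : realType) : {measure set (plane R) -> \bar R} :=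
  (@lebesgue_measure R \x @lebesgue_measure R)%E.

(* Squared Euclidean distance.  The norm and balls that the library puts on
   R * R are those of the sup norm, so they are not used here. *)
Definition sqdist (R : realType) (x y : plane R) : R :=
  (x.1 - y.1) ^+ 2 + (x.2 - y.2) ^+ 2.

Definition disc (R : realType) (p : plane R) (r : R) : set (plane R) :=
  [set x | Num.sqrt (sqdist x p) < r].

Lemma measurable_disc (R : realType) (p : plane R) (r : R) :
  measurable (disc p r).
Proof.
have mf : measurable_fun setT (fun x : plane R => Num.sqrt (sqdist x p)).
  apply: measurableT_comp.
    by apply: continuous_measurable_fun; exact: sqrt_continuous.
  apply: measurable_funD.
    apply: measurable_funX.
    by apply: measurable_funB.
  apply: measurable_funX.
  by apply: measurable_funB.
have := mf measurableT [set` `]-oo, r[] (measurable_itv _).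
by rewrite setTI; congr measurable; apply/seteqP; split => x /=; rewrite in_itv.
Qed.

(* The uniform probability measure A |-> area (A `&` D) / area D.  The Dirac
   mass is the value that mnormalize takes when area D is 0 or +oo. *)
Definition uniform (R : realType) (D : set (plane R)) (mD : measurable D) :
    probability (plane R) R :=
  mnormalize (mrestr (@area R) mD) (dirac ((0, 0) : plane R)).

Definition two_discs (R : realType) (p q : plane R) (r : R) : set (plane R) :=
  disc p r `|` disc q r.

Lemma measurable_two_discs (R : realType) (p q : plane R) (r : R) :
  measurable (two_discs p q r).
Proof. by apply: measurableU; exact: measurable_disc. Qed.

Definition four_discs (R : realType) : set (plane R) :=
  disc (1, 1) 1 `|` disc (1, -1) 1 `|` disc (-1, -1) 1 `|` disc (-1, 1) 1.

Lemma measurable_four_discs (R : realType) : measurable (@four_discs R).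
Proof. by do !apply: measurableU; exact: measurable_disc. Qed.

Definition nu0 (R : realType) : probability (plane R) R :=
  uniform (@measurable_four_discs R).

Definition nu11 (R : realType) (d eps : R) : probability (plane R) R :=
  uniform (measurable_two_discs (d, 0) (- d, 0) eps).

Definition nu12 (R : realType) (d eps : R) : probability (plane R) R :=
  uniform (measurable_two_discs (0, d) (0, - d) eps).

Definition finite_second_moment (R : realType) (mu : probability (plane R) R) :=
  (\int[mu]_x (sqdist x (0, 0))%:E < +oo)%E.

Definition coupling (R : realType) (mu nu : probability (plane R) R)
    (gamma : probability (plane R * plane R)%type R) :=
  forall A : set (plane R), measurable A ->
    gamma (A `*` setT) = mu A /\ gamma (setT `*` A) = nu A.

Definition transport_cost (R : realType) (mu nu : probability (plane R) R) :
    \bar R :=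
  ereal_inf [set (\int[gamma]_z (sqdist z.1 z.2)%:E)%E
            | gamma in [set gamma | coupling mu nu gamma]].

(* The cost is finite when mu and nu have finite second moments, so fine loses
   nothing there.  It would send an infinite cost to 0: W2 is only used between
   measures with finite second moments. *)
Definition W2 (R : realType) (mu nu : probability (plane R) R) : R :=
  Num.sqrt (fine (transport_cost mu nu)).

Definition barycenter_functional (R : realType) (t : R)
    (nu0 nu1 nu2 mu : probability (plane R) R) : R :=
  t * (2^-1 * (W2 mu nu1 ^+ 2 / 2) + 2^-1 * (W2 mu nu2 ^+ 2 / 2))
  - (t - 1) * (W2 mu nu0 ^+ 2 / 2).

Definition minimizers (R : realType) (t : R)
    (nu0 nu1 nu2 : probability (plane R) R) : set (probability (plane R) R) :=
  [set mu | finite_second_moment mu /\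
    forall mu', finite_second_moment mu' ->
      barycenter_functional t nu0 nu1 nu2 mu
      <= barycenter_functional t nu0 nu1 nu2 mu'].

Definition rotation (R : realType) (theta : R) (x : plane R) : plane R :=
  (cos theta * x.1 - sin theta * x.2, sin theta * x.1 + cos theta * x.2).

(* Equality of measures is equality on measurable sets; a probability is a
   function on all sets, whose values on the other sets are meaningless. *)
Definition same_measure (R : realType) (mu nu : set (plane R) -> \bar R) :=
  forall A : set (plane R), measurable A -> mu A = nu A.

Definition invariant_under (R : realType) (f : plane R -> plane R)
    (mu : probability (plane R) R) :=
  same_measure (pushforward mu f) mu.

(* Convexity for the linear interpolation (1 - s) mu1 + s mu2 of measures. *)
Definition convex_measures (R : realType) (S : set (probability (plane R) R)) :=
  forall mu1 mu2 mu : probability (plane R) R, S mu1 -> S mu2 ->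
  forall s : R, 0 <= s <= 1 ->
    same_measure mu (fun A => (1 - s)%:E * mu1 A + s%:E * mu2 A)%E ->
    S mu.

(* Main.v *)
(* Write [turn] for the rotation by pi/2, [k] and [m] for the means of [|y1|] and
   [|y1 + y2|] under [nu0], [N] for its second moment.  Since [turn] preserves
   [nu0] and exchanges [|y1 + y2|] and [|y1 - y2|], and [nu0] does not charge the
   axes, [m < 2 k].

   If [mu] is invariant under [turn], its four quadrants have the same mass, so
   [mu] and [nu0] have a coupling that matches quadrants with quadrants and is
   otherwise independent; its correlation is [k L] with [L] the mean of
   [|x1| + |x2|].  The correlations of [mu] with the two other measures add up to
   at most [(d + 2 eps) L].  Completing a square in [L], the functional at [mu] is
   at least [- (t (d + 2 eps) / 2 - (t - 1) k)^2] up to terms that do not depend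
   on [mu].  On the other hand, every coupling of [nu0] with a measure carried by
   [(c, c)] and [(- c, - c)] has correlation at most [c m]; for the best [c] this
   gives the value [- (t (d - 2 eps) / 2 - (t - 1) m / 2)^2] up to the same terms
   and an error of order [t d eps], which is smaller because [m / 2 < k].

   The set of minimizers is stable under [turn]; if it were convex, it would
   contain the average of the orbit of a minimizer, which is invariant. *)

Require Import Defs.
From HB Require Import structures.
From mathcomp Require Import all_boot all_order all_algebra.
From mathcomp Require Import all_classical all_reals all_analysis measurable_realfun.
From mathcomp Require Import ring lra.

Set Implicit Arguments.
Unset Strict Implicit.
Unset Printing Implicit Defensive.

Import Order.TTheory GRing.Theory Num.Theory.

Local Open Scope classical_set_scope.
Local Open Scope ring_scope.

(** * Couplings and transport costs *)

Lemma measurable_fst_plane (R : realType) d (T : measurableType d)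
  (f : T -> plane R) : measurable_fun setT f ->
  measurable_fun setT (fun x => (f x).1).
Proof. by move=> mf; exact: (measurableT_comp measurable_fst mf). Qed.

Lemma measurable_snd_plane (R : realType) d (T : measurableType d)
  (f : T -> plane R) : measurable_fun setT f ->
  measurable_fun setT (fun x => (f x).2).
Proof. by move=> mf; exact: (measurableT_comp measurable_snd mf). Qed.

Lemma measurable_sqdist (R : realType) d (T : measurableType d)
  (f g : T -> plane R) : measurable_fun setT f -> measurable_fun setT g ->
  measurable_fun setT (fun x => sqdist (f x) (g x)).
Proof.
move=> mf mg; apply: measurable_funD; apply: measurable_funX;
  apply: measurable_funB; do ?exact: measurable_fst_plane;
  exact: measurable_snd_plane.
Qed.

Lemma sqdist_ge0 (R : realType) (x y : plane R) : 0 <= sqdist x y.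
Proof. by rewrite addr_ge0 ?sqr_ge0. Qed.

Section laws.
Context d (T : measurableType d) (R : realType).

(** The image measure bundled as a probability, so that it can serve as a coupling or as a
    competitor. *)
Definition law d' (T' : measurableType d') (P : probability T R) (f : T -> T')
    (mf : measurable_fun setT f) : probability T' R :=
  distribution P
    (HB.pack_for {mfun T >-> T'} f (isMeasurableFun.Build _ _ _ _ f mf)).

Lemma lawE d' (T' : measurableType d') (P : probability T R) (f : T -> T')
    (mf : measurable_fun setT f) A : law P mf A = P (f @^-1` A).
Proof. by []. Qed.

(** Change of variables. [Q] has to agree with the image of [P] on measurable sets only, so that the
    marginals of a coupling qualify. *)
Lemma ge0_integral_law d' (T' : measurableType d') (P : probability T R)
    (f : T -> T') (Q : probability T' R) (g : T' -> R) :
  measurable_fun setT f -> (forall A, measurable A -> P (f @^-1` A) = Q A) ->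
  measurable_fun setT g -> (forall x, 0 <= g x) ->
  (\int[P]_x (g (f x))%:E = \int[Q]_x (g x)%:E)%E.
Proof.
move=> mf fPQ mg g0.
transitivity (\int[pushforward P f]_x (g x)%:E)%E.
  rewrite ge0_integral_pushforward//.
  - exact/measurable_EFinP.
  - by move=> x _; rewrite lee_fin.
by apply: eq_measure_integral => A mA _; exact: fPQ.
Qed.

End laws.

(** The joint law of [X] and [Y] is a coupling. Every upper bound on a transport cost below comes
    from such a pair of maps. *)
Lemma transport_cost_le_maps (R : realType) d (T : measurableType d)
    (P : probability T R) (X Y : T -> plane R) (mu nu : probability (plane R) R) :
  measurable_fun setT X -> measurable_fun setT Y ->
  (forall A, measurable A -> P (X @^-1` A) = mu A) ->
  (forall A, measurable A -> P (Y @^-1` A) = nu A) ->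
  (transport_cost mu nu <= \int[P]_w (sqdist (X w) (Y w))%:E)%E.
Proof.
move=> mX mY Xmu Ynu.
have mXY : measurable_fun setT (fun w => (X w, Y w)) by exact: measurable_fun_pair.
apply: ereal_inf_lbound; exists (law P mXY).
  move=> A mA; split; rewrite (lawE P mXY).
  - by rewrite -Xmu//; congr (P _); apply/seteqP; split=> x //= [].
  - by rewrite -Ynu//; congr (P _); apply/seteqP; split=> x //= [].
apply/esym; have := @ge0_integral_law _ _ _ _ _ P _ (law P mXY)
  (fun z : plane R * plane R => sqdist z.1 z.2) mXY.
apply => //.
- by apply: measurable_sqdist; [exact: measurable_fst|exact: measurable_snd].
- by move=> x; exact: sqdist_ge0.
Qed.

Lemma transport_cost_ge0 (R : realType) (mu nu : probability (plane R) R) :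
  (0 <= transport_cost mu nu)%E.
Proof.
apply: le_ereal_inf_tmp => _ [g _ <-]; apply: integral_ge0 => z _.
by rewrite lee_fin sqdist_ge0.
Qed.

Lemma W2_sqr (R : realType) (mu nu : probability (plane R) R) :
  W2 mu nu ^+ 2 = fine (transport_cost mu nu).
Proof. by rewrite sqr_sqrtr// fine_ge0// transport_cost_ge0. Qed.

Lemma W2_sqr_le (R : realType) (mu nu : probability (plane R) R) (r : R) :
  (transport_cost mu nu <= r%:E)%E -> W2 mu nu ^+ 2 <= r.
Proof.
move=> h; rewrite W2_sqr -lee_fin fineK// ge0_fin_numE ?transport_cost_ge0//.
by rewrite (le_lt_trans h)// ltry.
Qed.

(** Finiteness matters here, because [fine] sends an infinite cost to 0. *)
Lemma W2_sqr_ge (R : realType) (mu nu : probability (plane R) R) (r : R) :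
  (transport_cost mu nu < +oo)%E ->
  (r%:E <= transport_cost mu nu)%E -> r <= W2 mu nu ^+ 2.
Proof.
by move=> lty h; rewrite W2_sqr -lee_fin fineK// ge0_fin_numE ?transport_cost_ge0.
Qed.

(* The easy half of Kantorovich duality, with the potentials [g - f] and
   [h - k] split so that all the integrands are nonnegative. *)
Lemma transport_cost_dual (R : realType) (mu nu : probability (plane R) R)
    (S S' : set (plane R)) (f g h k : plane R -> R) :
  measurable S -> measurable S' -> mu (~` S) = 0%E -> nu (~` S') = 0%E ->
  measurable_fun setT f -> measurable_fun setT g ->
  measurable_fun setT h -> measurable_fun setT k ->
  (forall x, 0 <= f x) -> (forall x, 0 <= g x) ->
  (forall x, 0 <= h x) -> (forall x, 0 <= k x) ->
  (forall x y, S x -> S' y -> g x + h y <= sqdist x y + f x + k y) ->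
  forall a b c e : R,
    (\int[mu]_x (f x)%:E = a%:E)%E -> (\int[mu]_x (g x)%:E = b%:E)%E ->
    (\int[nu]_x (h x)%:E = c%:E)%E -> (\int[nu]_x (k x)%:E = e%:E)%E ->
  ((b + c - a - e)%:E <= transport_cost mu nu)%E.
Proof.
move=> mS mS' muS nuS' mf mg mh mk f0 g0 h0 k0 H a b c e fa gb hc ke.
apply: le_ereal_inf_tmp => _ [G cG <-].
have G1 A : measurable A -> G (fst @^-1` A) = mu A.
  move=> mA; rewrite -(cG A mA).1; congr (G _).
  by apply/seteqP; split=> x //= [].
have G2 A : measurable A -> G (snd @^-1` A) = nu A.
  move=> mA; rewrite -(cG A mA).2; congr (G _).
  by apply/seteqP; split=> x //= [].
have I1 (u : plane R -> R) : measurable_fun setT u -> (forall x, 0 <= u x) ->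
    (\int[G]_z (u z.1)%:E = \int[mu]_x (u x)%:E)%E.
  by move=> mu' u0; apply: ge0_integral_law => //; exact: measurable_fst.
have I2 (u : plane R -> R) : measurable_fun setT u -> (forall x, 0 <= u x) ->
    (\int[G]_z (u z.2)%:E = \int[nu]_x (u x)%:E)%E.
  by move=> mu' u0; apply: ge0_integral_law => //; exact: measurable_snd.
have M1 (u : plane R -> R) : measurable_fun setT u ->
    measurable_fun setT (fun z : plane R * plane R => (u z.1)%:E).
  move=> mu'; apply/measurable_EFinP.
  by apply: (measurableT_comp mu'); exact: measurable_fst.
have M2 (u : plane R -> R) : measurable_fun setT u ->
    measurable_fun setT (fun z : plane R * plane R => (u z.2)%:E).
  move=> mu'; apply/measurable_EFinP.
  by apply: (measurableT_comp mu'); exact: measurable_snd.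
have Ms : measurable_fun setT (fun z : plane R * plane R => (sqdist z.1 z.2)%:E).
  apply/measurable_EFinP.
  by apply: measurable_sqdist; [exact: measurable_fst|exact: measurable_snd].
have le : (\int[G]_z ((g z.1)%:E + (h z.2)%:E) <=
    \int[G]_z ((sqdist z.1 z.2)%:E + (f z.1)%:E + (k z.2)%:E))%E.
  apply: ae_ge0_le_integral => //.
  - by move=> z _; rewrite adde_ge0 ?lee_fin.
  - by apply: emeasurable_funD; [exact: M1|exact: M2].
  - by move=> z _; rewrite !adde_ge0 ?lee_fin ?sqdist_ge0.
  - by do !apply: emeasurable_funD => //; [exact: M1|exact: M2].
  (* The inequality between the potentials is known on [S] times [S'] only; the marginals of [G]
     make the complement negligible. *)
  have N1 : G.-negligible (fst @^-1` (~` S)).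
    apply/negligibleP; first by
      rewrite -[X in measurable X]setTI; apply: measurable_fst => //; exact: measurableC.
    by rewrite -muS; apply: G1; exact: measurableC.
  have N2 : G.-negligible (snd @^-1` (~` S')).
    apply/negligibleP; first by
      rewrite -[X in measurable X]setTI; apply: measurable_snd => //; exact: measurableC.
    by rewrite -nuS'; apply: G2; exact: measurableC.
  apply: (negligibleS _ (negligibleU N1 N2)) => z /= nz.
  have [Sz|] := pselect (S z.1); last by left.
  have [S'z|] := pselect (S' z.2); last by right.
  by exfalso; apply: nz => _; rewrite -!EFinD lee_fin; exact: H.
move: le; rewrite ge0_integralD//; last 4 first.
- by move=> z _; rewrite lee_fin.
- exact: M1.
- by move=> z _; rewrite lee_fin.
- exact: M2.
rewrite ge0_integralD//; last 4 first.
- by move=> z _; rewrite adde_ge0 ?lee_fin ?sqdist_ge0.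
- by apply: emeasurable_funD => //; exact: M1.
- by move=> z _; rewrite lee_fin.
- exact: M2.
rewrite ge0_integralD//; last 3 first.
- by move=> z _; rewrite lee_fin sqdist_ge0.
- by move=> z _; rewrite lee_fin.
- exact: M1.
rewrite !I1// !I2// fa gb hc ke.
(* The four potentials have real integrals, so only the cost can be infinite, and then the bound is
   trivial. *)
case: (\int[G]_z (sqdist z.1 z.2)%:E)%E => [r| |].
- by rewrite -!EFinD !lee_fin; lra.
- by move=> _; rewrite leey.
- by [].
Qed.

(** * Isometries of the plane and uniform measures *)

Lemma mnormalizeE d (T : measurableType d) (R : realType)
    (mu : {measure set T -> \bar R}) (P : probability T R) (A : set T) :
  mnormalize mu P A =
    if (mu setT == 0%E) || (mu setT == +oo%E) then P A
    else (mu A * (fine (mu setT))^-1%:E)%E.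
Proof. by rewrite /mnormalize; case: ifP. Qed.

Lemma mnormalize_mrestr d (T : measurableType d) (R : realType)
    (mu : {measure set T -> \bar R}) (P : probability T R) (D A : set T)
    (mD : measurable D) :
  mnormalize (mrestr mu mD) P A =
    if (mu D == 0%E) || (mu D == +oo%E) then P A
    else (mu (A `&` D) * (fine (mu D))^-1%:E)%E.
Proof.
transitivity (if (mu ([set: T] `&` D) == 0%E) || (mu ([set: T] `&` D) == +oo%E)
    then P A else (mu (A `&` D) * (fine (mu ([set: T] `&` D)))^-1%:E)%E).
  exact: mnormalizeE.
by rewrite setTI.
Qed.

Lemma uniform_if (R : realType) (D A : set (plane R)) (mD : measurable D) :
  uniform mD A =
    if (area R D == 0%E) || (area R D == +oo%E) then dirac ((0, 0) : plane R) A
    else (area R (A `&` D) * (fine (area R D))^-1%:E)%E.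
Proof. exact: mnormalize_mrestr. Qed.

Section isometries.
Context (R : realType).
Implicit Types (x y p : plane R) (A D : set (plane R)).

Definition turn x : plane R := (- x.2, x.1).

(** With [turn \o turn], which is [- id], it generates all sign changes of the two coordinates. *)
Definition mirror x : plane R := (- x.1, x.2).

Lemma rotation_pihalf : rotation (pi / 2) = turn.
Proof.
by apply/funext => x; rewrite /rotation cos_pihalf sin_pihalf /turn !mul0r !mul1r add0r addr0.
Qed.

Lemma turn4 x : turn (turn (turn (turn x))) = x.
Proof. by case: x => a b; rewrite /turn /= !opprK. Qed.

Lemma sqdist_turn x y : sqdist (turn x) (turn y) = sqdist x y.
Proof. by rewrite /sqdist /turn /=; ring. Qed.

Lemma measurable_turn : measurable_fun setT turn.
Proof.
apply: measurable_fun_pair => /=; last exact: measurable_fst_plane.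
by apply: measurableT_comp => //; exact: measurable_snd_plane.
Qed.

Lemma measurable_mirror : measurable_fun setT mirror.
Proof.
apply: measurable_fun_pair => /=; last exact: measurable_snd_plane.
by apply: measurableT_comp => //; exact: measurable_fst_plane.
Qed.

Lemma measurable_oppr_preimage (B : set (measurableTypeR R)) :
  measurable B -> measurable ((-%R : R -> measurableTypeR R) @^-1` B).
Proof.
have mo : measurable_fun setT (-%R : measurableTypeR R -> measurableTypeR R).
  by [].
by move=> mB; have := mo measurableT _ mB; rewrite setTI.
Qed.

Lemma area_box (B C : set (measurableTypeR R)) : measurable B -> measurable C ->
  area R (B `*` C) = (@lebesgue_measure R B * @lebesgue_measure R C)%E.
Proof. by move=> mB mC; exact: product_measure1E. Qed.

(** By uniqueness of the product measure, invariance of the area can be checked on boxes. *)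
Lemma area_preimage (f : plane R -> plane R) : measurable_fun setT f ->
  (forall B C : set (measurableTypeR R), measurable B -> measurable C ->
    area R (f @^-1` (B `*` C)) = area R (B `*` C)) ->
  forall A, measurable A -> area R (f @^-1` A) = area R A.
Proof.
move=> mf H A mA; apply/esym.
apply: (@product_measure_unique _ _ _ _ _ (@lebesgue_measure R)
  (@lebesgue_measure R) (measure_function_pushforward__canonical__measure_function_Measure
    (area R) mf)) => // B C mB mC.
by apply: (eq_trans (H B C mB mC)); exact: area_box.
Qed.

Lemma area_turn A : measurable A -> area R (turn @^-1` A) = area R A.
Proof.
apply: area_preimage => [|B C mB mC]; first exact: measurable_turn.
have -> : turn @^-1` (B `*` C) = C `*` ((-%R : R -> measurableTypeR R) @^-1` B).
  by apply/seteqP; split=> [] [a b] /= [].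
rewrite !area_box//; last exact: measurable_oppr_preimage.
by rewrite muleC; congr (_ * _)%E; exact: lebesgue_measureN.
Qed.

Lemma area_mirror A : measurable A -> area R (mirror @^-1` A) = area R A.
Proof.
apply: area_preimage => [|B C mB mC]; first exact: measurable_mirror.
have -> : mirror @^-1` (B `*` C) = ((-%R : R -> measurableTypeR R) @^-1` B) `*` C.
  by apply/seteqP; split=> [] [a b] /= [].
rewrite !area_box//; last exact: measurable_oppr_preimage.
by congr (_ * _)%E; exact: lebesgue_measureN.
Qed.

(** The condition at the origin takes care of the Dirac mass that [uniform] has as default value;
    thanks to it, nothing is asked of the area of [D]. *)
Lemma uniform_preimage (f : plane R -> plane R) D D' (mD : measurable D)
    (mD' : measurable D') : measurable_fun setT f -> f (0, 0) = (0, 0) ->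
  (forall A, measurable A -> area R (f @^-1` A) = area R A) ->
  f @^-1` D = D' ->
  forall A, measurable A -> uniform mD' (f @^-1` A) = uniform mD A.
Proof.
move=> mf f0 fA fD A mA; rewrite !uniform_if.
have -> : area R D' = area R D by rewrite -fD fA.
case: ifP => _.
  rewrite !diracE; congr ((_ : bool)%:R%:E).
  by apply/idP/idP => /set_mem h; apply/mem_set; move: h; rewrite /= f0.
congr (_ * _)%E; rewrite -fD -preimage_setI fA//.
exact: measurableI.
Qed.

End isometries.
Arguments turn {R} x.
Arguments mirror {R} x.

(** * Areas of discs and absolute continuity *)

Section uniform_measures.
Context (R : realType).
Implicit Types (p : plane R) (D : set (plane R)).

Lemma discE p (r : R) x : 0 < r -> disc p r x <-> sqdist x p < r ^+ 2.
Proof.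
move=> r0; rewrite /disc /= -[X in _ < X](ger0_norm (ltW r0)) -sqrtr_sqr.
by rewrite ltr_sqrt// exprn_gt0.
Qed.

(** Its area is a product of lengths. Squares bound discs from inside and outside, which shows that
    the area of a disc is positive and finite without computing it. *)
Definition square p (r : R) : set (plane R) :=
  `[p.1 - r, p.1 + r] `*` `[p.2 - r, p.2 + r].

Lemma measurable_square p (r : R) : measurable (square p r).
Proof. by apply: measurableX; exact: measurable_itv. Qed.

Lemma area_square p (r : R) : 0 < r ->
  area R (square p r) = (4 * r ^+ 2)%:E.
Proof.
move=> r0; rewrite /square area_box; try exact: measurable_itv.
rewrite !lebesgue_measure_itv /= !lte_fin.
do 2 (rewrite ifT; last lra).
by rewrite -!EFinD -EFinM; congr EFin; ring.
Qed.

Lemma ltr_sqr_itv (u r : R) : 0 < r -> u ^+ 2 < r ^+ 2 -> - r < u < r.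
Proof.
move=> r0; rewrite -ltr_norml -(real_normK (num_real u)) ltr_pXn2r ?nnegrE//.
exact: ltW.
Qed.

Lemma disc_sub_square p (r : R) : 0 < r ->
  disc p r `<=` square p r.
Proof.
move=> r0 x /(discE _ _ r0); rewrite /sqdist => h.
have H1 := sqr_ge0 (x.1 - p.1); have H2 := sqr_ge0 (x.2 - p.2).
have /andP[? ?] : - r < x.1 - p.1 < r by apply: ltr_sqr_itv => //; lra.
have /andP[? ?] : - r < x.2 - p.2 < r by apply: ltr_sqr_itv => //; lra.
by split => /=; rewrite in_itv /=; apply/andP; split; lra.
Qed.

Lemma square_sub_disc p (r : R) : 0 < r ->
  square p (r / 2) `<=` disc p r.
Proof.
move=> r0 x [] /=; rewrite !in_itv /= => /andP[a b] /andP[c e].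
have H u : - (r / 2) <= u <= r / 2 -> u ^+ 2 <= (r / 2) ^+ 2.
  by move=> /andP[? ?]; nra.
have H1 : (x.1 - p.1) ^+ 2 <= (r / 2) ^+ 2 by apply: H; apply/andP; split; lra.
have H2 : (x.2 - p.2) ^+ 2 <= (r / 2) ^+ 2 by apply: H; apply/andP; split; lra.
by apply/discE => //; rewrite /sqdist; nra.
Qed.

Lemma area_le A D : measurable A -> measurable D -> A `<=` D ->
  (area R A <= area R D)%E.
Proof. by move=> mA mD; apply: le_measure; rewrite inE. Qed.

Lemma area_disc_gt0 p (r : R) : 0 < r -> (0 < area R (disc p r))%E.
Proof.
move=> r0; have r2 : 0 < r / 2 by lra.
apply: lt_le_trans (area_le _ _ (@square_sub_disc p r r0)).
- by rewrite area_square// lte_fin; nra.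
- exact: measurable_square.
- exact: measurable_disc.
Qed.

Lemma area_disc_lty p (r : R) : 0 < r -> (area R (disc p r) < +oo)%E.
Proof.
move=> r0; apply: le_lt_trans (area_le _ _ (@disc_sub_square p r r0)) _.
- exact: measurable_disc.
- exact: measurable_square.
- by rewrite area_square// ltry.
Qed.

Lemma area_setU_gt0 D D' : measurable D -> measurable D' ->
  (0 < area R D)%E -> (0 < area R (D `|` D'))%E.
Proof.
move=> mD mD' D0; apply: (lt_le_trans D0); apply: area_le => //.
exact: measurableU.
Qed.

Lemma area_setU_lty D D' : measurable D -> measurable D' ->
  (area R D < +oo)%E -> (area R D' < +oo)%E -> (area R (D `|` D') < +oo)%E.
Proof.
move=> mD mD' D0 D1; apply: (le_lt_trans (measureU2 _ _ _)) => //.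
exact: lte_add_pinfty.
Qed.

Lemma uniformE D (mD : measurable D) A : (0 < area R D)%E ->
  (area R D < +oo)%E ->
  uniform mD A = (area R (A `&` D) * (fine (area R D))^-1%:E)%E.
Proof.
move=> D0 D1; rewrite uniform_if ifF//.
by apply/negbTE; rewrite negb_or gt_eqF// lt_eqF.
Qed.

Lemma uniform_setC D (mD : measurable D) : (0 < area R D)%E ->
  (area R D < +oo)%E -> uniform mD (~` D) = 0%E.
Proof. by move=> D0 D1; rewrite uniformE// setICl measure0 mul0e. Qed.

Lemma uniform_dominated D (mD : measurable D) : (0 < area R D)%E ->
  (area R D < +oo)%E -> uniform mD `<< area R.
Proof.
move=> D0 D1; apply/null_content_dominatesP => A mA A0.
rewrite uniformE// (_ : area R (A `&` D) = 0%E) ?mul0e//.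
by apply: (subset_measure0 _ _ _ A0) => //; exact: measurableI.
Qed.

Lemma area_two_discs p q (r : R) : 0 < r ->
  (0 < area R (two_discs p q r) < +oo)%E.
Proof.
move=> r0; apply/andP; split.
  by apply: area_setU_gt0; do ?exact: measurable_disc; exact: area_disc_gt0.
by apply: area_setU_lty; do ?exact: measurable_disc; exact: area_disc_lty.
Qed.

Lemma area_four_discs : (0 < area R (@four_discs R) < +oo)%E.
Proof.
have M p := measurable_disc p (1 : R).
have U1 := measurableU _ _ (M (1, 1)) (M (1, -1)).
have U2 := measurableU _ _ U1 (M (-1, -1)).
have G p := @area_disc_gt0 p 1 ltr01.
have L p := @area_disc_lty p 1 ltr01.
apply/andP; split.
  exact: area_setU_gt0 U2 (M _) (area_setU_gt0 U1 (M _) (area_setU_gt0 (M _) (M _) (G _))).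
exact: area_setU_lty U2 (M _) (area_setU_lty U1 (M _)
  (area_setU_lty (M _) (M _) (L _) (L _)) (L _)) (L _).
Qed.

End uniform_measures.

(** * Moments *)

Section nu.
Context (R : realType).

Lemma preimage_turn_disc (a b r : R) : turn @^-1` disc (a, b) r = disc (b, - a) r.
Proof.
have E (x : plane R) : sqdist (turn x) (a, b) = sqdist x (b, - a).
  by rewrite /sqdist /turn /=; ring.
by apply/seteqP; split=> x; rewrite /preimage /disc /= E.
Qed.

Lemma preimage_mirror_disc (a b r : R) : mirror @^-1` disc (a, b) r = disc (- a, b) r.
Proof.
have E (x : plane R) : sqdist (mirror x) (a, b) = sqdist x (- a, b).
  by rewrite /sqdist /mirror /=; ring.
by apply/seteqP; split=> x; rewrite /preimage /disc /= E.
Qed.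

Lemma nu0_turn (A : set (plane R)) : measurable A -> nu0 R (turn @^-1` A) = nu0 R A.
Proof.
apply: uniform_preimage.
- exact: measurable_turn.
- by rewrite /turn /= oppr0.
- exact: area_turn.
- rewrite /four_discs !preimage_setU !preimage_turn_disc opprK.
  by apply/seteqP; split=> x /=; tauto.
Qed.

Lemma nu0_mirror (A : set (plane R)) : measurable A -> nu0 R (mirror @^-1` A) = nu0 R A.
Proof.
apply: uniform_preimage.
- exact: measurable_mirror.
- by rewrite /mirror /= oppr0.
- exact: area_mirror.
- rewrite /four_discs !preimage_setU !preimage_mirror_disc opprK.
  by apply/seteqP; split=> x /=; tauto.
Qed.

Lemma nu11_turn (d eps : R) (A : set (plane R)) : measurable A ->
  nu11 d eps (turn @^-1` A) = nu12 d eps A.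
Proof.
apply: uniform_preimage.
- exact: measurable_turn.
- by rewrite /turn /= oppr0.
- exact: area_turn.
- by rewrite /two_discs preimage_setU !preimage_turn_disc oppr0.
Qed.

Lemma nu12_turn (d eps : R) (A : set (plane R)) : measurable A ->
  nu12 d eps (turn @^-1` A) = nu11 d eps A.
Proof.
apply: uniform_preimage.
- exact: measurable_turn.
- by rewrite /turn /= oppr0.
- exact: area_turn.
- by rewrite /two_discs preimage_setU !preimage_turn_disc opprK setUC.
Qed.

Lemma nu0_support : nu0 R (~` @four_discs R) = 0%E.
Proof. by have /andP[? ?] := area_four_discs R; exact: uniform_setC. Qed.

Lemma nu11_support (d eps : R) : 0 < eps ->
  nu11 d eps (~` two_discs (d, 0) (- d, 0) eps) = 0%E.
Proof.
by move=> e0; have /andP[? ?] := area_two_discs (d, 0) (- d, 0) e0; exact: uniform_setC.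
Qed.

End nu.

(** * Integrals of nonnegative functions under a probability *)

Section moments.
Context d (T : measurableType d) (R : realType) (P : probability T R).

(** Domination yields a real value, so that the later computations with moments take place in
    [R]. *)
Lemma ge0_integral_fin (f g : T -> R) :
  measurable_fun setT f -> measurable_fun setT g ->
  (forall x, 0 <= f x) -> (forall x, f x <= g x) ->
  (\int[P]_x (g x)%:E < +oo)%E -> exists r, (\int[P]_x (f x)%:E = r%:E)%E /\ 0 <= r.
Proof.
move=> mf mg f0 fg glty.
have i0 : (0 <= \int[P]_x (f x)%:E)%E.
  by apply: integral_ge0 => x _; rewrite lee_fin.
have ilty : (\int[P]_x (f x)%:E < +oo)%E.
  apply: le_lt_trans glty; apply: ge0_le_integral => //.
  - by move=> x _; rewrite lee_fin.
  - exact/measurable_EFinP.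
  - exact/measurable_EFinP.
  - by move=> x _; rewrite lee_fin.
exists (fine (\int[P]_x (f x)%:E)); split; last exact: fine_ge0.
by rewrite fineK// ge0_fin_numE.
Qed.

Lemma integral_cst_probability (K : R) : (\int[P]_x K%:E = K%:E)%E.
Proof.
transitivity (K%:E * P setT)%E; first exact: integral_cst.
by rewrite probability_setT mule1.
Qed.

Lemma ge0_integral_le_cst (S : set T) (f : T -> R) (K : R) :
  measurable S -> P (~` S) = 0%E ->
  measurable_fun setT f -> (forall x, 0 <= f x) -> 0 <= K ->
  (forall x, S x -> f x <= K) -> (\int[P]_x (f x)%:E <= K%:E)%E.
Proof.
move=> mS S0 mf f0 K0 fK.
rewrite -[leRHS]integral_cst_probability.
apply: ae_ge0_le_integral => //.
- by move=> x _; rewrite lee_fin.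
- exact/measurable_EFinP.
exists (~` S); split => //; first exact: measurableC.
by move=> x /= h Sx; apply: h => _; rewrite lee_fin fK.
Qed.

Lemma measurable_lin2 (f g : T -> R) (a b : R) :
  measurable_fun setT f -> measurable_fun setT g ->
  measurable_fun setT (fun x => a * f x + b * g x).
Proof. by move=> mf mg; apply: measurable_funD; exact: measurable_funM. Qed.

(** Stated for nonnegative data to avoid integrability conditions. Many integrands below carry
    factors such as [1 *] to match this form. *)
Lemma integral_lin2 (f g : T -> R) (a b : R) :
  measurable_fun setT f -> measurable_fun setT g ->
  (forall x, 0 <= f x) -> (forall x, 0 <= g x) -> 0 <= a -> 0 <= b ->
  (\int[P]_x (a * f x + b * g x)%:E =
   a%:E * \int[P]_x (f x)%:E + b%:E * \int[P]_x (g x)%:E)%E.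
Proof.
move=> mf mg f0 g0 a0 b0.
have E (h : T -> R) c : measurable_fun setT h -> (forall x : T, 0 <= h x) -> 0 <= c ->
    (\int[P]_x (c * h x)%:E = c%:E * \int[P]_x (h x)%:E)%E.
  move=> mh h0 c0; under eq_integral do rewrite EFinM.
  rewrite ge0_integralZl_EFin//; first by move=> x _; rewrite lee_fin.
  exact/measurable_EFinP.
under eq_integral do rewrite EFinD.
rewrite ge0_integralD//.
- by rewrite !E.
- by move=> x _; rewrite lee_fin mulr_ge0.
- by apply/measurable_EFinP; exact: measurable_funM.
- by move=> x _; rewrite lee_fin mulr_ge0.
- by apply/measurable_EFinP; exact: measurable_funM.
Qed.

Lemma ge0_integral_add4 (f1 f2 f3 f4 : T -> R) :
  measurable_fun setT f1 -> measurable_fun setT f2 ->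
  measurable_fun setT f3 -> measurable_fun setT f4 ->
  (forall x, 0 <= f1 x) -> (forall x, 0 <= f2 x) ->
  (forall x, 0 <= f3 x) -> (forall x, 0 <= f4 x) ->
  (\int[P]_x (f1 x + f2 x + f3 x + f4 x)%:E =
   \int[P]_x (f1 x)%:E + \int[P]_x (f2 x)%:E + \int[P]_x (f3 x)%:E +
   \int[P]_x (f4 x)%:E)%E.
Proof.
move=> m1 m2 m3 m4 p1 p2 p3 p4.
have E (f g : T -> R) : measurable_fun setT f -> measurable_fun setT g ->
    (forall x, 0 <= f x) -> (forall x, 0 <= g x) ->
    (\int[P]_x (f x + g x)%:E = \int[P]_x (f x)%:E + \int[P]_x (g x)%:E)%E.
  move=> mf mg f0 g0; under eq_integral do rewrite EFinD.
  rewrite ge0_integralD//; try by move=> x _; rewrite lee_fin.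
    exact/measurable_EFinP.
  exact/measurable_EFinP.
have m12 : measurable_fun setT (fun x => f1 x + f2 x) by exact: measurable_funD.
have p12 x : 0 <= f1 x + f2 x by rewrite addr_ge0.
rewrite (E (fun x => f1 x + f2 x + f3 x) f4)//; last 2 first.
- exact: measurable_funD.
- by move=> x; rewrite addr_ge0.
by rewrite (E (fun x => f1 x + f2 x) f3)// E.
Qed.

End moments.

(** * Second moments and the product coupling *)

Section second_moment.
Context (R : realType).
Implicit Types mu nu : probability (plane R) R.

Definition sqnorm (x : plane R) : R := sqdist x (0, 0).

Lemma sqnormE x : sqnorm x = x.1 ^+ 2 + x.2 ^+ 2.
Proof. by rewrite /sqnorm /sqdist /= !subr0. Qed.

Lemma measurable_sqnorm : measurable_fun setT sqnorm.
Proof. by apply: measurable_sqdist => //; exact: measurable_cst. Qed.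

Lemma sqnorm_ge0 x : 0 <= sqnorm x. Proof. exact: sqdist_ge0. Qed.

Lemma measurable_abs1 : measurable_fun setT (fun x : plane R => `|x.1|).
Proof. by apply: measurableT_comp => //; exact: measurable_fst_plane. Qed.

Lemma measurable_abs2 : measurable_fun setT (fun x : plane R => `|x.2|).
Proof. by apply: measurableT_comp => //; exact: measurable_snd_plane. Qed.

(** The first moments are finite since [|x_i| <= 1 + |x|^2]. *)
Lemma finite_second_momentP mu : finite_second_moment mu ->
  exists M a1 a2, [/\ (\int[mu]_x (sqnorm x)%:E = M%:E)%E,
    (\int[mu]_x (`|x.1|)%:E = a1%:E)%E & (\int[mu]_x (`|x.2|)%:E = a2%:E)%E].
Proof.
move=> h.
have [M [EM _]] := ge0_integral_fin measurable_sqnorm measurable_sqnorm sqnorm_ge0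
  (fun=> lexx _) h.
have mg : measurable_fun setT (fun x => 1 * 1 + 1 * sqnorm x).
  by apply: measurable_funD => //; apply: measurable_funM => //; exact: measurable_sqnorm.
have lty : (\int[mu]_x (1 * 1 + 1 * sqnorm x)%:E < +oo)%E.
  rewrite (@integral_lin2 _ _ _ mu (cst 1) sqnorm)//; last 2 first.
  - exact: measurable_sqnorm.
  - exact: sqnorm_ge0.
  by rewrite EM !mul1e integral_cst_probability -EFinD ltry.
have le1 (x : plane R) : `|x.1| <= 1 * 1 + 1 * sqnorm x.
  rewrite sqnormE -(real_normK (num_real x.1)).
  by have := sqr_ge0 (`|x.1| - 1); have := sqr_ge0 x.2; nra.
have le2 (x : plane R) : `|x.2| <= 1 * 1 + 1 * sqnorm x.
  rewrite sqnormE -(real_normK (num_real x.2)).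
  by have := sqr_ge0 (`|x.2| - 1); have := sqr_ge0 x.1; nra.
have [a1 [E1 _]] := ge0_integral_fin measurable_abs1 mg (fun=> normr_ge0 _) le1 lty.
have [a2 [E2 _]] := ge0_integral_fin measurable_abs2 mg (fun=> normr_ge0 _) le2 lty.
by exists M, a1, a2.
Qed.

Lemma prob_fst mu nu (A : set (plane R)) : measurable A ->
  (mu \x nu)%E (fst @^-1` A) = mu A.
Proof.
move=> mA; have -> : fst @^-1` A = A `*` [set: plane R].
  by apply/seteqP; split=> x //= [].
transitivity (mu A * nu setT)%E; first exact: product_measure1E.
by rewrite probability_setT mule1.
Qed.

Lemma prob_snd mu nu (A : set (plane R)) : measurable A ->
  (mu \x nu)%E (snd @^-1` A) = nu A.
Proof.
move=> mA; have -> : snd @^-1` A = [set: plane R] `*` A.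
  by apply/seteqP; split=> x //= [].
transitivity (mu setT * nu A)%E; first exact: product_measure1E.
by rewrite probability_setT mul1e.
Qed.

Definition prodP mu nu : probability (plane R * plane R)%type R := (mu \x nu)%E.

(** The product coupling has finite cost, by [|x - y|^2 <= 2 |x|^2 + 2 |y|^2]. *)
Lemma transport_cost_lty mu nu : finite_second_moment mu ->
  finite_second_moment nu -> (transport_cost mu nu < +oo)%E.
Proof.
move=> hmu hnu.
have m1 : measurable_fun setT (fun z : plane R * plane R => sqnorm z.1).
  by apply: (measurableT_comp measurable_sqnorm); exact: measurable_fst.
have m2 : measurable_fun setT (fun z : plane R * plane R => sqnorm z.2).
  by apply: (measurableT_comp measurable_sqnorm); exact: measurable_snd.
apply: (@le_lt_trans _ _ (\int[prodP mu nu]_z (sqdist z.1 z.2)%:E)%E).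
  apply: transport_cost_le_maps.
  - exact: measurable_fst.
  - exact: measurable_snd.
  - by move=> A mA; exact: prob_fst.
  - by move=> A mA; exact: prob_snd.
apply: (@le_lt_trans _ _ (\int[prodP mu nu]_z (2 * sqnorm z.1 + 2 * sqnorm z.2)%:E)%E).
  apply: ge0_le_integral => //.
  - by move=> z _; rewrite lee_fin sqdist_ge0.
  - apply/measurable_EFinP; apply: measurable_sqdist; [exact: measurable_fst|exact: measurable_snd].
  - by apply/measurable_EFinP; apply: measurable_funD; exact: measurable_funM.
  - move=> z _; rewrite lee_fin !sqnormE /sqdist.
    have := sqr_ge0 (z.1.1 + z.2.1); have := sqr_ge0 (z.1.2 + z.2.2); lra.
rewrite (@integral_lin2 _ _ _ (prodP mu nu) (fun z => sqnorm z.1) (fun z => sqnorm z.2))//;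
  try by move=> z; exact: sqnorm_ge0.
rewrite (@ge0_integral_law _ _ _ _ _ (prodP mu nu) fst mu sqnorm); last 4 first.
- exact: measurable_fst.
- by move=> A mA; exact: prob_fst.
- exact: measurable_sqnorm.
- exact: sqnorm_ge0.
rewrite (@ge0_integral_law _ _ _ _ _ (prodP mu nu) snd nu sqnorm); last 4 first.
- exact: measurable_snd.
- by move=> A mA; exact: prob_snd.
- exact: measurable_sqnorm.
- exact: sqnorm_ge0.
by rewrite lte_add_pinfty// lte_mul_pinfty.
Qed.

End second_moment.

(** * The quadrant coupling *)

Section quadrant_coupling.
Context (R : realType).
Implicit Types (x y : plane R) (A : set (plane R)) (mu nu : probability (plane R) R).

Definition turn_invariant mu :=
  forall A, measurable A -> mu (turn @^-1` A) = mu A.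

(* The signs of the coordinates, with ties on the axes broken so that the
   quadrants [{sign1 = a, sign2 = b}] of the punctured plane are permuted
   cyclically by [turn]. *)
Definition sign1 x : R :=
  if (0 < x.1) || ((x.1 == 0) && (x.2 < 0)) then 1 else -1.

Definition sign2 x : R :=
  if (0 < x.2) || ((x.2 == 0) && (0 < x.1)) then 1 else -1.

(** The fixed point of [turn], set apart because no choice of signs there is compatible with the
    rotation. *)
Definition is_origin x := (x.1 == 0) && (x.2 == 0).

Lemma is_origin_turn x : is_origin (turn x) = is_origin x.
Proof. by rewrite /is_origin /turn /= oppr_eq0 andbC. Qed.

Lemma sign1_turn x : ~~ is_origin x -> sign1 (turn x) = - sign2 x.
Proof.
rewrite /sign1 /sign2 /is_origin /turn /= oppr_gt0 oppr_eq0.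
by case: (ltrgt0P x.1); case: (ltrgt0P x.2); rewrite ?opprK //= ?oppr0.
Qed.

Lemma sign2_turn x : ~~ is_origin x -> sign2 (turn x) = sign1 x.
Proof. by rewrite /sign1 /sign2 /turn /= oppr_gt0. Qed.

Lemma sign1P x : sign1 x = 1 \/ sign1 x = -1.
Proof. by rewrite /sign1; case: ifP; [left|right]. Qed.

Lemma sign2P x : sign2 x = 1 \/ sign2 x = -1.
Proof. by rewrite /sign2; case: ifP; [left|right]. Qed.

(* Moves [y] to the quadrant of [x] by reflections in the axes. *)
Definition to_quadrant (z : plane R * plane R) : plane R :=
  if is_origin z.1 then z.2
  else (sign1 z.1 * `|z.2.1|, sign2 z.1 * `|z.2.2|).

(** Once [y] is reflected into the quadrant of [x], its norm is unchanged and its inner product with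
    [x] is [|x1| |y1| + |x2| |y2|]. *)
Lemma sqdist_to_quadrant x y :
  sqdist x (to_quadrant (x, y)) + 2 * (`|x.1| * `|y.1| + `|x.2| * `|y.2|) =
  sqnorm x + sqnorm y.
Proof.
rewrite !sqnormE /to_quadrant /=; case: ifP => [/andP[/eqP x1 /eqP x2]|_].
  by rewrite /sqdist x1 x2 normr0; ring.
rewrite /sqdist /= -(real_normK (num_real y.1)) -(real_normK (num_real y.2)).
(* Ties are broken only where the coordinate vanishes, so the sign chosen there is harmless. *)
have E1 : x.1 = sign1 x * `|x.1|.
  rewrite /sign1; case: (ltrgt0P x.1) => /= h; rewrite ?h ?mulr0 ?mul1r//.
  by rewrite mulN1r opprK.
have E2 : x.2 = sign2 x * `|x.2|.
  rewrite /sign2; case: (ltrgt0P x.2) => /= h; rewrite ?h ?mulr0 ?mul1r//.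
  by rewrite mulN1r opprK.
move: (normr_ge0 x.1) (normr_ge0 x.2) E1 E2.
generalize `|x.1| `|x.2| => p q p0 q0 -> ->.
by case: (sign1P x) => ->; case: (sign2P x) => ->;
  rewrite ?mul1r ?mulN1r ?normrN (ger0_norm p0) (ger0_norm q0); ring.
Qed.

Lemma measurable_sign1 : measurable_fun setT sign1.
Proof.
apply: measurable_fun_ifT => //; apply: measurable_or.
  apply: measurable_fun_ltr => //; exact: measurable_fst_plane.
apply: measurable_and.
  by apply: measurable_fun_eqr => //; exact: measurable_fst_plane.
by apply: measurable_fun_ltr => //; exact: measurable_snd_plane.
Qed.

Lemma measurable_sign2 : measurable_fun setT sign2.
Proof.
apply: measurable_fun_ifT => //; apply: measurable_or.
  apply: measurable_fun_ltr => //; exact: measurable_snd_plane.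
apply: measurable_and.
  by apply: measurable_fun_eqr => //; exact: measurable_snd_plane.
by apply: measurable_fun_ltr => //; exact: measurable_fst_plane.
Qed.

Lemma measurable_is_origin : measurable_fun setT is_origin.
Proof.
by apply: measurable_and; apply: measurable_fun_eqr.
Qed.

Lemma measurable_to_quadrant : measurable_fun setT to_quadrant.
Proof.
have mf : measurable_fun setT (fst : plane R * plane R -> plane R) by exact: measurable_fst.
have ms : measurable_fun setT (snd : plane R * plane R -> plane R) by exact: measurable_snd.
apply: measurable_fun_ifT => //.
  exact: (measurableT_comp measurable_is_origin mf).
apply: measurable_fun_pair.
  apply: measurable_funM; first exact: (measurableT_comp measurable_sign1 mf).
  exact: (measurableT_comp (@measurable_abs1 R) ms).
apply: measurable_funM; first exact: (measurableT_comp measurable_sign2 mf).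
exact: (measurableT_comp (@measurable_abs2 R) ms).
Qed.


(** This gives the second marginal of the quadrant coupling. For fixed [x], the law of
    [to_quadrant (x, y)] depends on the quadrant of [x] only, and its mean over the four quadrants
    is [nu] because [nu] is invariant under sign changes. Invariance of [mu] gives the quadrants
    equal weights; this is used by summing along the orbits of [turn]. *)
Lemma preimage_to_quadrant_turn mu nu A : turn_invariant mu ->
  turn_invariant nu ->
  (forall B, measurable B -> nu (mirror @^-1` B) = nu B) ->
  measurable A -> prodP mu nu (@to_quadrant @^-1` A) = nu A.
Proof.
move=> hmu hnu hnu' mA.
have mB : measurable (@to_quadrant @^-1` A).
  by rewrite -[X in measurable X]setTI; exact: measurable_to_quadrant.
set B := to_quadrant @^-1` A in mB *.
(* The chance that [y], moved to the quadrant of [x], falls in [A]. *)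
pose g x := fine (nu (xsection B x)).
pose c := fine (nu A).
have fin C : measurable C -> (fine (nu C))%:E = nu C.
  by move=> mC; rewrite fineK// fin_num_measure.
have cE : c%:E = nu A by exact: fin.
have mt := @measurable_turn R.
have mm := @measurable_mirror R.
have sec x : xsection B x = (fun y => to_quadrant (x, y)) @^-1` A.
  by apply/seteqP; split=> y; rewrite /xsection /= inE.
have mg : measurable_fun setT g.
  apply: (measurableT_comp (fine_measurable _)) => //.
  exact: measurable_fun_xsection.
have g0 x : 0 <= g x by apply: fine_ge0.
have gE : (prodP mu nu B = \int[mu]_x (g x)%:E)%E.
  rewrite /prodP /= /product_measure1; apply: eq_integral => x _.
  by rewrite /= fin//; exact: measurable_xsection.
have gt (f : plane R -> R) : measurable_fun setT f -> (forall x, 0 <= f x) ->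
    (\int[mu]_x (f (turn x))%:E = \int[mu]_x (f x)%:E)%E.
  by move=> mf f0; exact: (ge0_integral_law mt hmu).
have m1 : measurable_fun setT (g \o turn) by exact: measurableT_comp.
have m2 : measurable_fun setT (g \o turn \o turn) by exact: measurableT_comp.
have m3 : measurable_fun setT (g \o turn \o turn \o turn) by exact: measurableT_comp.
have i1 : (\int[mu]_x (g (turn x))%:E = \int[mu]_x (g x)%:E)%E by exact: gt.
have i2 : (\int[mu]_x (g (turn (turn x)))%:E = \int[mu]_x (g x)%:E)%E.
  by rewrite -i1; apply: (gt (g \o turn)) => // x; exact: g0.
have i3 : (\int[mu]_x (g (turn (turn (turn x))))%:E = \int[mu]_x (g x)%:E)%E.
  by rewrite -i2; apply: (gt (g \o turn \o turn)) => // x; exact: g0.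
(* The value of [g] on the quadrant with signs [a] and [b]. *)
pose G a b := fine (nu ((fun y => (a * `|y.1|, b * `|y.2|) : plane R) @^-1` A)).
have gG x : ~~ is_origin x -> g x = G (sign1 x) (sign2 x).
  move=> nx; rewrite /g /G sec; congr (fine (nu _)).
  by apply/seteqP; split=> y; rewrite /preimage /= /to_quadrant /= (negbTE nx).
have g_origin x : is_origin x -> g x = c.
  move=> ox; rewrite /g sec; congr (fine (nu _)).
  by apply/seteqP; split=> y; rewrite /preimage /= /to_quadrant /= ox.
have nuI (f : plane R -> plane R) : measurable_fun setT f ->
    (\int[nu]_y (\1_A (f y))%:E = nu (f @^-1` A))%E.
  move=> mf; rewrite -[f @^-1` A]setIT -integral_indic//.
  by rewrite -[X in measurable X]setTI; exact: mf.
have mI (f : plane R -> plane R) : measurable_fun setT f ->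
    measurable_fun setT (fun y => \1_A (f y) : R).
  by move=> mf; apply: (measurableT_comp _ mf); exact: measurable_indic.
have I0 (f : plane R -> plane R) y : 0 <= \1_A (f y) :> R by [].
have ms a b : measurable_fun setT (fun y => (a * `|y.1|, b * `|y.2|) : plane R).
  apply: measurable_fun_pair; apply: measurable_funM => //.
    exact: measurable_abs1.
  exact: measurable_abs2.
have sumG : G 1 1 + G 1 (-1) + G (-1) 1 + G (-1) (-1) = 4 * c.
  have mid : measurable_fun setT (idfun : plane R -> plane R) by exact: measurable_id.
  have mt2 : measurable_fun setT (turn \o turn : plane R -> plane R).
    exact: measurableT_comp.
  have mmt : measurable_fun setT (mirror \o (turn \o turn) : plane R -> plane R).
    exact: measurableT_comp.
  have mA' f : measurable_fun setT f -> measurable (f @^-1` A : set (plane R)).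
    by move=> mf; rewrite -[X in measurable X]setTI; exact: mf.
  have eG a b : (\int[nu]_y (\1_A ((a * `|y.1|, b * `|y.2|) : plane R))%:E = (G a b)%:E)%E.
    by rewrite (nuI _ (ms a b)) /G fin//; exact: mA'.
  have e1 : (\int[nu]_y (\1_A (idfun y))%:E = c%:E)%E.
    by rewrite cE; apply: nuI; exact: measurable_id.
  have e2 : (\int[nu]_y (\1_A (mirror y))%:E = c%:E)%E by rewrite cE -(hnu' A mA); exact: nuI.
  have e3 : (\int[nu]_y (\1_A ((turn \o turn) y))%:E = c%:E)%E.
    rewrite cE -(hnu A mA) -(hnu (turn @^-1` A)); last exact: mA'.
    exact: nuI.
  have e4 : (\int[nu]_y (\1_A ((mirror \o (turn \o turn)) y))%:E = c%:E)%E.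
    rewrite cE -(hnu' A mA) -(hnu (mirror @^-1` A)); last exact: mA'.
    rewrite -(hnu (turn @^-1` (mirror @^-1` A))); first exact: nuI.
    exact: (mA' (mirror \o turn) (measurableT_comp mm mt)).
  pose F a b y := \1_A ((a * `|y.1|, b * `|y.2|) : plane R) : R.
  have mF a b : measurable_fun setT (F a b) by exact: (mI _ (ms a b)).
  have F0 a b y : 0 <= F a b y by [].
  (* The four points with coordinates [|y1|] and [|y2|] up to sign are, in some order, [y] and its
     images under the sign changes. *)
  have key : (\int[nu]_y (F 1 1 y + F 1 (-1) y + F (-1) 1 y + F (-1) (-1) y)%:E =
    \int[nu]_y (\1_A (idfun y) + \1_A (mirror y) + \1_A ((turn \o turn) y) +
      \1_A ((mirror \o (turn \o turn)) y))%:E)%E.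
    apply: eq_integral => -[a b] _; congr (_%:E).
    rewrite /F /turn /mirror /= !opprK !mul1r !mulN1r.
    by case: (ger0P a) => _; case: (ger0P b) => _; rewrite ?opprK; ring.
  have L := ge0_integral_add4 nu (mF 1 1) (mF 1 (-1)) (mF (-1) 1) (mF (-1) (-1))
    (F0 _ _) (F0 _ _) (F0 _ _) (F0 _ _).
  have L' := ge0_integral_add4 nu (mI idfun mid) (mI mirror mm)
    (mI _ mt2) (mI _ mmt) (I0 _) (I0 _) (I0 _) (I0 _).
  move: key; rewrite L L' !eG e1 e2 e3 e4 -!EFinD => -[]; lra.
(* Off the origin, the orbit of [x] visits each quadrant once; at the origin, [g] is already [c]. *)
have gsum x : g x + g (turn x) + g (turn (turn x)) +
    g (turn (turn (turn x))) = 4 * c.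
  have [ox|nx] := boolP (is_origin x).
    by rewrite !g_origin ?is_origin_turn//; ring.
  rewrite !gG ?is_origin_turn// !(sign1_turn, sign2_turn) ?is_origin_turn//.
  rewrite -sumG; case: (sign1P x) => ->; case: (sign2P x) => ->; rewrite ?opprK; ring.
have : (\int[mu]_x (4 * c)%:E = \int[mu]_x (g x + g (turn x) +
    g (turn (turn x)) + g (turn (turn (turn x))))%:E)%E.
  by apply: eq_integral => x _; rewrite gsum.
have L : (\int[mu]_x (g x + g (turn x) + g (turn (turn x)) +
      g (turn (turn (turn x))))%:E =
    \int[mu]_x (g x)%:E + \int[mu]_x (g (turn x))%:E +
    \int[mu]_x (g (turn (turn x)))%:E + \int[mu]_x (g (turn (turn (turn x))))%:E)%E.
  exact: (ge0_integral_add4 mu mg m1 m2 m3 g0 (fun=> g0 _) (fun=> g0 _) (fun=> g0 _)).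
rewrite integral_cst_probability L i1 i2 i3 -gE -cE.
have : prodP mu nu B \is a fin_num by apply: fin_num_measure.
move: (prodP mu nu B) => [r| |]// _.
by rewrite -!EFinD => -[] h; congr EFin; lra.
Qed.

End quadrant_coupling.

(** * Bounds on the Wasserstein distance *)

Section W2_bounds.
Context (R : realType).
Implicit Types (x y : plane R) (mu nu : probability (plane R) R).

Lemma ge0_integral_prodP mu nu (f g : plane R -> R) (a b : R) :
  measurable_fun setT f -> measurable_fun setT g ->
  (forall x, 0 <= f x) -> (forall x, 0 <= g x) -> 0 <= b ->
  (\int[mu]_x (f x)%:E = a%:E)%E -> (\int[nu]_x (g x)%:E = b%:E)%E ->
  (\int[prodP mu nu]_z (f z.1 * g z.2)%:E = (a * b)%:E)%E.
Proof.
move=> mf mg f0 g0 b0 fa gb.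
have mfg : measurable_fun setT (fun z : plane R * plane R => (f z.1 * g z.2)%:E).
  apply/measurable_EFinP; apply: measurable_funM.
    by apply: (measurableT_comp mf); exact: measurable_fst.
  by apply: (measurableT_comp mg); exact: measurable_snd.
transitivity (\int[mu]_x \int[nu]_y (f x * g y)%:E)%E.
  apply: (@fubini_tonelli1 _ _ _ _ _ mu nu (fun z => (f z.1 * g z.2)%:E)) => //.
  by move=> z; rewrite lee_fin mulr_ge0.
transitivity (\int[mu]_x (b%:E * (f x)%:E))%E.
  apply: eq_integral => x _; under eq_integral do rewrite EFinM.
  rewrite ge0_integralZl_EFin//; last 2 first.
  - by move=> y _; rewrite lee_fin.
  - exact/measurable_EFinP.
  by rewrite gb muleC.
rewrite ge0_integralZl_EFin//; last 2 first.
- by move=> y _; rewrite lee_fin.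
- exact/measurable_EFinP.
by rewrite fa -EFinM mulrC.
Qed.

(** The bound is the cost of the quadrant coupling: [x] and [y] are independent before the
    reflection, so the mean of [|x1| |y1| + |x2| |y2|] splits into products of first moments. *)
Lemma W2_turn_invariant_le mu nu (M N a1 a2 b1 b2 : R) :
  turn_invariant mu -> turn_invariant nu ->
  (forall B, measurable B -> nu (mirror @^-1` B) = nu B) ->
  (\int[mu]_x (sqnorm x)%:E = M%:E)%E -> (\int[nu]_x (sqnorm x)%:E = N%:E)%E ->
  (\int[mu]_x (`|x.1|)%:E = a1%:E)%E -> (\int[mu]_x (`|x.2|)%:E = a2%:E)%E ->
  (\int[nu]_x (`|x.1|)%:E = b1%:E)%E -> (\int[nu]_x (`|x.2|)%:E = b2%:E)%E ->
  W2 mu nu ^+ 2 <= M + N - 2 * (a1 * b1 + a2 * b2).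
Proof.
move=> hmu hnu hnu' EM EN Ea1 Ea2 Eb1 Eb2.
have mf : measurable_fun setT (fst : plane R * plane R -> plane R) by exact: measurable_fst.
have ms : measurable_fun setT (snd : plane R * plane R -> plane R) by exact: measurable_snd.
have b10 : 0 <= b1.
  by rewrite -lee_fin -Eb1; apply: integral_ge0 => x _; rewrite lee_fin.
have b20 : 0 <= b2.
  by rewrite -lee_fin -Eb2; apply: integral_ge0 => x _; rewrite lee_fin.
have mq := @measurable_to_quadrant R.
have le : (transport_cost mu nu <=
    \int[prodP mu nu]_z (sqdist z.1 (to_quadrant z))%:E)%E.
  apply: transport_cost_le_maps => //.
  - by move=> A mA; exact: prob_fst.
  - by move=> A mA; exact: preimage_to_quadrant_turn.
apply: W2_sqr_le; apply: (le_trans le).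
pose sq (z : plane R * plane R) := sqdist z.1 (to_quadrant z).
pose p (z : plane R * plane R) := `|z.1.1| * `|z.2.1|.
pose q (z : plane R * plane R) := `|z.1.2| * `|z.2.2|.
have msq : measurable_fun setT sq by exact: measurable_sqdist.
have mp : measurable_fun setT p.
  apply: measurable_funM.
    exact: (measurableT_comp (@measurable_abs1 R) mf).
  exact: (measurableT_comp (@measurable_abs1 R) ms).
have mq' : measurable_fun setT q.
  apply: measurable_funM.
    exact: (measurableT_comp (@measurable_abs2 R) mf).
  exact: (measurableT_comp (@measurable_abs2 R) ms).
have p0 z : 0 <= p z by rewrite mulr_ge0.
have q0 z : 0 <= q z by rewrite mulr_ge0.
have sq0 z : 0 <= sq z by exact: sqdist_ge0.
have m1 : measurable_fun setT (fun z : plane R * plane R => sqnorm z.1).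
  exact: (measurableT_comp (@measurable_sqnorm R) mf).
have m2 : measurable_fun setT (fun z : plane R * plane R => sqnorm z.2).
  exact: (measurableT_comp (@measurable_sqnorm R) ms).
have Lp : (\int[prodP mu nu]_z (p z)%:E = (a1 * b1)%:E)%E.
  exact: (ge0_integral_prodP (@measurable_abs1 R) (@measurable_abs1 R)).
have Lq : (\int[prodP mu nu]_z (q z)%:E = (a2 * b2)%:E)%E.
  exact: (ge0_integral_prodP (@measurable_abs2 R) (@measurable_abs2 R)).
have L1 : (\int[prodP mu nu]_z (sqnorm z.1)%:E = M%:E)%E.
  rewrite -EM; apply: (ge0_integral_law mf) => //.
  - by move=> A mA; exact: prob_fst.
  - exact: measurable_sqnorm.
  - exact: sqnorm_ge0.
have L2 : (\int[prodP mu nu]_z (sqnorm z.2)%:E = N%:E)%E.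
  rewrite -EN; apply: (ge0_integral_law ms) => //.
  - by move=> A mA; exact: prob_snd.
  - exact: measurable_sqnorm.
  - exact: sqnorm_ge0.
have Lpq : (\int[prodP mu nu]_z (1 * p z + 1 * q z)%:E = (a1 * b1 + a2 * b2)%:E)%E.
  by rewrite integral_lin2// Lp Lq !mul1e -EFinD.
have LM : (\int[prodP mu nu]_z (1 * sqnorm z.1 + 1 * sqnorm z.2)%:E = (M + N)%:E)%E.
  rewrite (@integral_lin2 _ _ _ (prodP mu nu) (fun z => sqnorm z.1) (fun z => sqnorm z.2))//;
    try by move=> z; exact: sqnorm_ge0.
  by rewrite L1 L2 !mul1e -EFinD.
have m12 : measurable_fun setT (fun z => 1 * p z + 1 * q z) by exact: measurable_lin2.
have pq0 z : 0 <= 1 * p z + 1 * q z by rewrite addr_ge0// mulr_ge0.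
(* The identity is integrated as a sum of nonnegative terms, and the cost is isolated afterwards
   among real numbers. *)
have : (\int[prodP mu nu]_z (1 * sq z + 2 * (1 * p z + 1 * q z))%:E = (M + N)%:E)%E.
  rewrite -LM; apply: eq_integral => -[x y] _; congr EFin.
  by rewrite !mul1r /sq /p /q /= sqdist_to_quadrant.
rewrite (integral_lin2 (prodP mu nu) msq m12 sq0 pq0 ler01)// Lpq mul1e.
rewrite -/(sq _); case: (\int[prodP mu nu]_z (sq z)%:E)%E => [r| |] //.
by rewrite -EFinM -EFinD => -[] h; rewrite lee_fin; lra.
Qed.

Lemma W2_dual_ge mu nu (S S' : set (plane R)) (f g h k : plane R -> R) :
  measurable S -> measurable S' -> mu (~` S) = 0%E -> nu (~` S') = 0%E ->
  measurable_fun setT f -> measurable_fun setT g ->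
  measurable_fun setT h -> measurable_fun setT k ->
  (forall x, 0 <= f x) -> (forall x, 0 <= g x) ->
  (forall x, 0 <= h x) -> (forall x, 0 <= k x) ->
  (forall x y, S x -> S' y -> g x + h y <= sqdist x y + f x + k y) ->
  finite_second_moment mu -> finite_second_moment nu ->
  forall a b c e : R,
    (\int[mu]_x (f x)%:E = a%:E)%E -> (\int[mu]_x (g x)%:E = b%:E)%E ->
    (\int[nu]_x (h x)%:E = c%:E)%E -> (\int[nu]_x (k x)%:E = e%:E)%E ->
  b + c - a - e <= W2 mu nu ^+ 2.
Proof.
move=> mS mS' muS nuS' mf mg mh mk f0 g0 h0 k0 H fmu fnu a b c e fa gb hc ke.
apply: W2_sqr_ge; first exact: transport_cost_lty.
exact: (transport_cost_dual mS mS' muS nuS' mf mg mh mk f0 g0 h0 k0 H fa gb hc ke).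
Qed.

Lemma W2_same mu nu mu' nu' :
  (transport_cost mu' nu' <= transport_cost mu nu)%E ->
  (transport_cost mu nu <= transport_cost mu' nu')%E ->
  W2 mu nu = W2 mu' nu'.
Proof. by move=> h1 h2; rewrite /W2; congr (Num.sqrt (fine _)); apply/eqP; rewrite eq_le h1 h2. Qed.

(** Applying [f] to both components of a coupling couples the image measures at the same cost. *)
Lemma transport_cost_le_isometry (f : plane R -> plane R) mu nu mu' nu' :
  measurable_fun setT f -> (forall x y, sqdist (f x) (f y) = sqdist x y) ->
  (forall A, measurable A -> mu (f @^-1` A) = mu' A) ->
  (forall A, measurable A -> nu (f @^-1` A) = nu' A) ->
  (transport_cost mu' nu' <= transport_cost mu nu)%E.
Proof.
move=> mf fiso hmu hnu; apply: le_ereal_inf_tmp => _ [G cG <-].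
have mfA A : measurable A -> measurable (f @^-1` A).
  by move=> mA; rewrite -[X in measurable X]setTI; exact: mf.
have m1 : measurable_fun setT (fst : plane R * plane R -> plane R) by exact: measurable_fst.
have m2 : measurable_fun setT (snd : plane R * plane R -> plane R) by exact: measurable_snd.
have -> : (\int[G]_z (sqdist z.1 z.2)%:E = \int[G]_z (sqdist (f z.1) (f z.2))%:E)%E.
  by apply: eq_integral => z _; rewrite fiso.
apply: (transport_cost_le_maps (measurableT_comp mf m1) (measurableT_comp mf m2)).
- move=> A mA; rewrite -hmu// -(cG _ (mfA _ mA)).1; congr (G _).
  by apply/seteqP; split=> z //= [].
- move=> A mA; rewrite -hnu// -(cG _ (mfA _ mA)).2; congr (G _).
  by apply/seteqP; split=> z //= [].
Qed.

Lemma W2_turn mu nu mu' nu' :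
  (forall A, measurable A -> mu (turn @^-1` A) = mu' A) ->
  (forall A, measurable A -> nu (turn @^-1` A) = nu' A) ->
  W2 mu' nu' = W2 mu nu.
Proof.
move=> hmu hnu.
(* Since [turn] has order four, its cube is its inverse, which yields the converse inequality. *)
pose inv := turn \o (turn \o turn) : plane R -> plane R.
have mi : measurable_fun setT inv.
  apply: measurableT_comp; first exact: measurable_turn.
  by apply: measurableT_comp; exact: measurable_turn.
have mA' A : measurable A -> measurable (inv @^-1` A).
  by move=> mA; rewrite -[X in measurable X]setTI; exact: mi.
have tK A : turn @^-1` (inv @^-1` A) = A.
  by apply/seteqP; split=> x; rewrite /preimage /inv /= turn4.
apply: W2_same.
  apply: (transport_cost_le_isometry mi).
  - by move=> x y; rewrite /inv /= !sqdist_turn.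
  - by move=> A mA; rewrite -hmu ?tK//; exact: mA'.
  - by move=> A mA; rewrite -hnu ?tK//; exact: mA'.
apply: (transport_cost_le_isometry (@measurable_turn R)) => //.
exact: sqdist_turn.
Qed.

End W2_bounds.

(** * Moments of the three measures *)

Section nu_moments.
Context (R : realType).
Implicit Types (x y : plane R) (mu : probability (plane R) R).

Lemma two_discs_bounds (d eps : R) y : 0 < eps -> 0 <= d ->
  two_discs (d, 0) (- d, 0) eps y ->
  [/\ d - eps <= `|y.1|, `|y.1| <= d + eps, `|y.2| <= eps
    & sqnorm y <= (d + eps) ^+ 2].
Proof.
move=> e0 d0 Dy.
(* The sign of the centre treats the two discs at once. *)
have [s [s1 Hs]] : exists s : R, (s = 1 \/ s = -1) /\
    (y.1 - s * d) ^+ 2 + y.2 ^+ 2 < eps ^+ 2.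
  case: Dy => /(discE _ _ e0); rewrite /sqdist /= subr0 => h.
    by exists 1; rewrite mul1r; split => //; left.
  by exists (-1); rewrite mulN1r; split => //; right.
have H1 := sqr_ge0 (y.1 - s * d); have H2 := sqr_ge0 y.2.
have /andP[? ?] : - eps < y.1 - s * d < eps by apply: ltr_sqr_itv => //; lra.
have /andP[? ?] : - eps < y.2 < eps by apply: ltr_sqr_itv => //; lra.
have [? ?] : d - eps <= `|y.1| /\ `|y.1| <= d + eps.
  have ? := ler_norm y.1; have ? := lerNnormlW (lexx `|y.1|).
  by case: s1 => ss; subst s; split; rewrite ?ler_norml; try (apply/andP; split); lra.
split => //; first by rewrite ler_norml; apply/andP; split; lra.
by rewrite sqnormE; case: s1 => ss; subst s; nra.
Qed.

Lemma finite_second_moment_bounded mu (S : set (plane R)) (K : R) :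
  measurable S -> mu (~` S) = 0%E -> 0 <= K -> (forall x, S x -> sqnorm x <= K) ->
  finite_second_moment mu.
Proof.
move=> mS S0 K0 H; apply: (@le_lt_trans _ _ K%:E); last by rewrite ltry.
apply: (ge0_integral_le_cst mS S0) => //; first exact: measurable_sqnorm.
exact: sqnorm_ge0.
Qed.

Lemma nu11_finite_second_moment (d eps : R) : 0 < eps -> 0 <= d ->
  finite_second_moment (nu11 d eps).
Proof.
move=> e0 d0; apply: (finite_second_moment_bounded (measurable_two_discs _ _ _)
  (nu11_support d e0) (sqr_ge0 (d + eps))) => y Dy.
by have [] := two_discs_bounds e0 d0 Dy.
Qed.

Lemma sqnorm_turn x : sqnorm (turn x) = sqnorm x.
Proof. by rewrite !sqnormE /turn /=; ring. Qed.

Lemma integral_turn mu mu' (f : plane R -> R) :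
  (forall A, measurable A -> mu (turn @^-1` A) = mu' A) ->
  measurable_fun setT f -> (forall x, 0 <= f x) ->
  (\int[mu']_x (f x)%:E = \int[mu]_x (f (turn x))%:E)%E.
Proof.
by move=> h mf f0; apply/esym; apply: (ge0_integral_law (@measurable_turn R)).
Qed.

Lemma finite_second_moment_turn mu mu' :
  (forall A, measurable A -> mu (turn @^-1` A) = mu' A) ->
  finite_second_moment mu -> finite_second_moment mu'.
Proof.
move=> h fmu; rewrite /finite_second_moment.
rewrite (integral_turn h (@measurable_sqnorm R) (@sqnorm_ge0 R)).
by under eq_integral do rewrite sqnorm_turn.
Qed.

(** The open discs are tangent to the axes and do not meet them, which is what makes [m < 2 * k]
    strict. The constant 8 is a round bound above [(1 + sqrt 2)^2]. *)
Lemma four_discsP y : @four_discs R y ->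
  [/\ 0 < `|y.1|, 0 < `|y.2| & sqnorm y <= 8].
Proof.
have H (a b : R) : a ^+ 2 = 1 -> b ^+ 2 = 1 -> disc (a, b) 1 y ->
    [/\ 0 < `|y.1|, 0 < `|y.2| & sqnorm y <= 8].
  move=> a1 b1 /(discE _ _ ltr01); rewrite /sqdist /= => h.
  have H1 := sqr_ge0 (y.1 - a); have H2 := sqr_ge0 (y.2 - b).
  rewrite !normr_gt0 sqnormE; split.
  - by apply/eqP => y0; move: h; rewrite y0; nra.
  - by apply/eqP => y0; move: h; rewrite y0; nra.
  - have := sqr_ge0 (y.1 - a - a); have := sqr_ge0 (y.2 - b - b); nra.
have E1 : (-1) ^+ 2 = 1 :> R by ring.
have E2 : 1 ^+ 2 = 1 :> R by ring.
by case=> [[[]|]|]; apply: H.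
Qed.

Lemma measurable_abs_sum : measurable_fun setT (fun y : plane R => `|y.1 + y.2|).
Proof.
apply: measurableT_comp => //; apply: measurable_funD.
  exact: measurable_fst_plane.
exact: measurable_snd_plane.
Qed.

Lemma measurable_abs_diff : measurable_fun setT (fun y : plane R => `|y.1 - y.2|).
Proof.
apply: measurableT_comp => //; apply: measurable_funB.
  exact: measurable_fst_plane.
exact: measurable_snd_plane.
Qed.

Lemma nu0_finite_second_moment : finite_second_moment (nu0 R).
Proof.
apply: (finite_second_moment_bounded (@measurable_four_discs R) (@nu0_support R)
  (_ : 0 <= 8)) => // y /four_discsP[].
by [].
Qed.

(* [|y1 + y2| + |y1 - y2| < 2 (|y1| + |y2|)] off the axes, and the two terms on
   the left have the same mean because [turn] exchanges them. *)
Lemma nu0_moments : exists N k m : R,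
  [/\ (\int[nu0 R]_y (sqnorm y)%:E = N%:E)%E,
      (\int[nu0 R]_y (`|y.1|)%:E = k%:E)%E, (\int[nu0 R]_y (`|y.2|)%:E = k%:E)%E,
      (\int[nu0 R]_y (`|y.1 + y.2|)%:E = m%:E)%E & 0 <= m < 2 * k].
Proof.
have [N [k [k' [EN Ek Ek']]]] := finite_second_momentP nu0_finite_second_moment.
have kk : k' = k.
  apply/EFin_inj; rewrite -Ek -Ek'.
  by rewrite (integral_turn (@nu0_turn R) (@measurable_abs2 R) (fun=> normr_ge0 _)).
rewrite {}kk in Ek'.
pose s y : R := 1 * `|y.1| + 1 * `|y.2|.
have ms : measurable_fun setT s.
  exact: (measurable_lin2 _ _ (@measurable_abs1 R) (@measurable_abs2 R)).
have s0 y : 0 <= s y by rewrite addr_ge0// mulr_ge0.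
have Es : (\int[nu0 R]_y (s y)%:E = (2 * k)%:E)%E.
  rewrite (integral_lin2 (nu0 R) (@measurable_abs1 R) (@measurable_abs2 R)
    (fun=> normr_ge0 _) (fun=> normr_ge0 _) ler01 ler01).
  by rewrite Ek Ek' !mul1e -EFinD; congr EFin; ring.
have ls y : `|y.1 + y.2| <= s y by rewrite /s !mul1r ler_normD.
have sty : (\int[nu0 R]_y (s y)%:E < +oo)%E by rewrite Es ltry.
have [m [Em m0]] := ge0_integral_fin measurable_abs_sum ms (fun=> normr_ge0 _) ls sty.
have Em' : (\int[nu0 R]_y (`|y.1 - y.2|)%:E = m%:E)%E.
  rewrite -Em (integral_turn (@nu0_turn R) measurable_abs_sum (fun=> normr_ge0 _)).
  by apply: eq_integral => y _; rewrite /turn /= addrC.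
(* The gap in the triangle inequalities, whose mean [Q] is [4 * k - 2 * m]; it remains to see that
   [Q] is not 0. *)
pose q y : R := 2 * s y - (1 * `|y.1 + y.2| + 1 * `|y.1 - y.2|).
have ma := measurable_lin2 1 1 measurable_abs_sum measurable_abs_diff.
have a0 y : 0 <= 1 * `|y.1 + y.2| + 1 * `|y.1 - y.2| by rewrite addr_ge0// mulr_ge0.
have mq : measurable_fun setT q by apply: measurable_funB => //; exact: measurable_funM.
have q0 y : 0 <= q y.
  rewrite /q /s !mul1r; have := ler_normD y.1 y.2; have := ler_normB y.1 y.2; lra.
have qs y : q y <= 1 * s y + 1 * s y by rewrite /q; have := a0 y; lra.
have m2s : measurable_fun setT (fun y => 1 * s y + 1 * s y) by exact: measurable_lin2.
have lty : (\int[nu0 R]_y (1 * s y + 1 * s y)%:E < +oo)%E.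
  by rewrite (integral_lin2 (nu0 R) ms ms s0 s0 ler01 ler01) Es !mul1e -EFinD ltry.
have [Q [EQ Q0]] := ge0_integral_fin mq m2s q0 qs lty.
have Ea : (\int[nu0 R]_y (1 * `|y.1 + y.2| + 1 * `|y.1 - y.2|)%:E = (2 * m)%:E)%E.
  rewrite (integral_lin2 (nu0 R) measurable_abs_sum measurable_abs_diff
    (fun=> normr_ge0 _) (fun=> normr_ge0 _) ler01 ler01).
  by rewrite Em Em' !mul1e -EFinD; congr EFin; ring.
have Qeq : Q + 2 * m = 4 * k.
  have : (\int[nu0 R]_y (1 * q y + 1 * (1 * `|y.1 + y.2| + 1 * `|y.1 - y.2|))%:E =
      \int[nu0 R]_y (1 * s y + 1 * s y)%:E)%E.
    by apply: eq_integral => y _; congr EFin; rewrite /q; ring.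
  rewrite (integral_lin2 (nu0 R) mq ma q0 a0 ler01 ler01).
  rewrite (integral_lin2 (nu0 R) ms ms s0 s0 ler01 ler01).
  by rewrite EQ Ea Es !mul1e -!EFinD => -[]; lra.
exists N, k, m; split => //; rewrite m0 /=.
suff : Q != 0 by move=> Qn0; have : 0 < Q by [rewrite lt_def Qn0 Q0]; lra.
(* If [Q] were 0, [q] would vanish almost everywhere; as [q] is positive on the four discs, these
   would have mass 0, although they carry all of [nu0]. *)
apply/eqP => Qz.
have mqE : measurable_fun setT (fun y => (q y)%:E) by exact/measurable_EFinP.
have Z : (\int[nu0 R]_y `|(q y)%:E| = 0)%E.
  rewrite -[RHS]/(0%:E) -Qz -EQ; apply: eq_integral => y _.
  by rewrite gee0_abs// lee_fin.
have [N' [mN' N'0 sub]] := (ae_eq_integral_abs (nu0 R) measurableT mqE).1 Z.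
have sub' : @four_discs R `<=` N'.
  move=> y /four_discsP[y1 y2 _]; apply: sub => /= /(_ Logic.I) [].
  rewrite /q /s !mul1r => h.
  have : `|y.1 + y.2| + `|y.1 - y.2| < 2 * (`|y.1| + `|y.2|).
    move: y1 y2; clear.
    case: (ger0P y.1) => ?; case: (ger0P y.2) => ?; case: (ger0P (y.1 + y.2)) => ?;
      case: (ger0P (y.1 - y.2)) => ?; lra.
  by move: h; clear; lra.
have F0 : nu0 R (@four_discs R) = 0%E.
  by apply: (subset_measure0 _ mN' sub' N'0); exact: measurable_four_discs.
have := @probability_setC _ _ _ (nu0 R) _ (@measurable_four_discs R).
rewrite nu0_support F0 sube0 => /eqP; rewrite eq_sym.
by rewrite onee_eq0.
Qed.

End nu_moments.

(** * Invariant measures and competitors *)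

Section functional_bounds.
Context (R : realType).
Implicit Types (x y : plane R) (mu nu : probability (plane R) R).

(** For [y] in the two discs, [x.y <= (d + eps) |x1| + eps |x2|] and [|y|^2 >= (d - eps)^2]; these
    bounds are the dual potentials. *)
Lemma W2_nu11_ge mu (d eps M a1 a2 : R) : 0 < eps -> eps <= d ->
  finite_second_moment mu ->
  (\int[mu]_x (sqnorm x)%:E = M%:E)%E ->
  (\int[mu]_x (`|x.1|)%:E = a1%:E)%E -> (\int[mu]_x (`|x.2|)%:E = a2%:E)%E ->
  M + (d - eps) ^+ 2 - (2 * (d + eps) * a1 + 2 * eps * a2) <= W2 mu (nu11 d eps) ^+ 2.
Proof.
move=> e0 ed fmu EM E1 E2; have d0 : 0 <= d by lra.
have c1 : 0 <= 2 * (d + eps) by lra.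
have c2 : 0 <= 2 * eps by lra.
rewrite -[leLHS]subr0; apply: (@W2_dual_ge _ _ _ setT (two_discs (d, 0) (- d, 0) eps)
  (fun x => 2 * (d + eps) * `|x.1| + 2 * eps * `|x.2|) (@sqnorm R)
  (fun=> (d - eps) ^+ 2) (fun=> 0)) => //.
- exact: measurable_two_discs.
- by rewrite setCT measure0.
- exact: nu11_support.
- exact: (measurable_lin2 _ _ (@measurable_abs1 R) (@measurable_abs2 R)).
- exact: measurable_sqnorm.
- by move=> x; rewrite addr_ge0// mulr_ge0.
- exact: sqnorm_ge0.
- by move=> y; rewrite sqr_ge0.
- move=> x y _ /(two_discs_bounds e0 d0)[h1 h2 h3 _].
  have k1 : x.1 * y.1 <= (d + eps) * `|x.1|.
    apply: (le_trans (ler_norm _)); rewrite normrM mulrC.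
    exact: ler_wpM2r.
  have k2 : x.2 * y.2 <= eps * `|x.2|.
    apply: (le_trans (ler_norm _)); rewrite normrM mulrC.
    exact: ler_wpM2r.
  have k3 : (d - eps) ^+ 2 <= y.1 ^+ 2.
    rewrite -(real_normK (num_real y.1)); nra.
  rewrite sqnormE /sqdist addr0; have := sqr_ge0 y.2; nra.
- exact: nu11_finite_second_moment.
- rewrite (integral_lin2 mu (@measurable_abs1 R) (@measurable_abs2 R)
    (fun=> normr_ge0 _) (fun=> normr_ge0 _) c1 c2).
  by rewrite E1 E2 -!EFinM -EFinD.
- exact: integral_cst_probability.
- exact: integral_cst_probability.
Qed.

(** The bound for [nu11] is applied to the rotated measure, whose first moments are exchanged. *)
Lemma W2_nu12_ge mu (d eps M a1 a2 : R) : 0 < eps -> eps <= d ->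
  finite_second_moment mu ->
  (\int[mu]_x (sqnorm x)%:E = M%:E)%E ->
  (\int[mu]_x (`|x.1|)%:E = a1%:E)%E -> (\int[mu]_x (`|x.2|)%:E = a2%:E)%E ->
  M + (d - eps) ^+ 2 - (2 * (d + eps) * a2 + 2 * eps * a1) <= W2 mu (nu12 d eps) ^+ 2.
Proof.
move=> e0 ed fmu EM E1 E2.
pose mu' := law mu (@measurable_turn R).
have h A : measurable A -> mu (turn @^-1` A) = mu' A by [].
rewrite -(W2_turn h (@nu12_turn _ d eps)).
apply: W2_nu11_ge => //.
- exact: finite_second_moment_turn h fmu.
- rewrite (integral_turn h (@measurable_sqnorm R) (@sqnorm_ge0 R)) -EM.
  by apply: eq_integral => x _; rewrite sqnorm_turn.
- rewrite (integral_turn h (@measurable_abs1 R) (fun=> normr_ge0 _)) -E2.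
  by apply: eq_integral => x _; rewrite /turn /= normrN.
- by rewrite (integral_turn h (@measurable_abs2 R) (fun=> normr_ge0 _)) -E1.
Qed.

(** Integrates [(|x1| - s)^2 + (|x2| - s)^2 >= 0]; the choice [s = B] will complete the square. *)
Lemma second_moment_ge mu (M a1 a2 s : R) : 0 <= s ->
  (\int[mu]_x (sqnorm x)%:E = M%:E)%E ->
  (\int[mu]_x (`|x.1|)%:E = a1%:E)%E -> (\int[mu]_x (`|x.2|)%:E = a2%:E)%E ->
  2 * s * a1 + 2 * s * a2 <= M + 2 * s ^+ 2.
Proof.
move=> s0 EM E1 E2; have s20 : 0 <= 2 * s by lra.
have s2 : 0 <= 2 * s ^+ 2 by rewrite mulr_ge0// sqr_ge0.
rewrite -lee_fin 2!EFinD !(EFinM (2 * s)) -E1 -E2.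
rewrite -(integral_lin2 mu (@measurable_abs1 R) (@measurable_abs2 R)
    (fun=> normr_ge0 _) (fun=> normr_ge0 _) s20 s20).
have -> : (M%:E + (2 * s ^+ 2)%:E = \int[mu]_x (1 * sqnorm x + 2 * s ^+ 2 * 1)%:E)%E.
  rewrite (integral_lin2 mu (@measurable_sqnorm R) (measurable_cst (1 : R))
    (@sqnorm_ge0 R) (fun=> ler01) ler01 s2).
  by rewrite EM integral_cst_probability mul1e mule1.
apply: ge0_le_integral => //.
- by move=> x _; rewrite lee_fin addr_ge0// mulr_ge0.
- apply/measurable_EFinP.
  exact: (measurable_lin2 _ _ (@measurable_abs1 R) (@measurable_abs2 R)).
- apply/measurable_EFinP.
  exact: (measurable_lin2 _ _ (@measurable_sqnorm R) (measurable_cst (1 : R))).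
- move=> x _; rewrite lee_fin sqnormE.
  rewrite -(real_normK (num_real x.1)) -(real_normK (num_real x.2)).
  have := sqr_ge0 (`|x.1| - s); have := sqr_ge0 (`|x.2| - s); nra.
Qed.

(** * A competitor carried by two points of the diagonal *)

Section competitor.
Variables (d eps c : R).
Hypotheses (e0 : 0 < eps) (ed : eps <= d) (c0 : 0 < c).

(** As [eps <= d], the right disc goes to [(c, c)] and the left one to [(- c, - c)]. Being defined
    on the space of [nu11], this map gives the competitor together with its couplings with [nu11]
    and, through [turn], with [nu12]. *)
Definition two_points y : plane R := if 0 <= y.1 then (c, c) else (- c, - c).

Lemma measurable_two_points : measurable_fun setT two_points.
Proof.
apply: measurable_fun_ifT => //; first exact: measurable_fun_ler.
Qed.

Definition competitor : probability (plane R) R :=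
  law (nu11 d eps) measurable_two_points.

Let Sc : set (plane R) := ([set c] `*` [set c]) `|` ([set - c] `*` [set - c]).

Let mSc : measurable Sc.
Proof. by apply: measurableU; apply: measurableX. Qed.

Let competitor_support : competitor (~` Sc) = 0%E.
Proof.
rewrite lawE (_ : _ @^-1` _ = set0) ?measure0//.
apply/seteqP; split=> // y /=; rewrite /two_points; case: ifP => _; apply.
  by left.
by right.
Qed.

Lemma competitor_finite_second_moment : finite_second_moment competitor.
Proof.
apply: (finite_second_moment_bounded mSc competitor_support (_ : 0 <= 2 * c ^+ 2)).
  by nra.
by move=> x [] [/= x1 x2]; rewrite sqnormE x1 x2; lra.
Qed.

(** In the coupling of [two_points y] with [y], the correlation is at least
    [c (|y1| - |y2|) >= c (d - 2 eps)], and [|y| <= d + eps]. *)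
Lemma competitor_nu11_le :
  W2 competitor (nu11 d eps) ^+ 2 <= 2 * c ^+ 2 - 2 * c * (d - 2 * eps) + (d + eps) ^+ 2.
Proof.
have d0 : 0 <= d := le_trans (ltW e0) ed.
have mid : measurable_fun setT (idfun : plane R -> plane R) by exact: measurable_id.
apply: W2_sqr_le; apply: le_trans.
  apply: (@transport_cost_le_maps _ _ _ (nu11 d eps) two_points idfun) => //.
  exact: measurable_two_points.
apply: (ge0_integral_le_cst (measurable_two_discs _ _ _) (nu11_support d e0)).
- exact: measurable_sqdist measurable_two_points mid.
- by move=> x; exact: sqdist_ge0.
- by have := sqr_ge0 (c - d); have := mulr_gt0 c0 e0; have := sqr_ge0 (d + eps); move: (c0) (e0) (d0); nra.
- move=> y /(two_discs_bounds e0 d0)[]; rewrite sqnormE /two_points /sqdist /=.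
  move=> h1 h2 h3 h5; have c0' := c0.
  have h4 := ler_norm y.2; have h6 := lerNnormlW (lexx `|y.2|).
  by case: (ger0P y.1) h1 h2 => y0 /= h1 h2; nra.
Qed.

(** [turn] takes the right disc to the upper one, so pairing [two_points y] with [turn y] obeys the
    same bounds. *)
Lemma competitor_nu12_le :
  W2 competitor (nu12 d eps) ^+ 2 <= 2 * c ^+ 2 - 2 * c * (d - 2 * eps) + (d + eps) ^+ 2.
Proof.
have d0 : 0 <= d := le_trans (ltW e0) ed.
apply: W2_sqr_le; apply: le_trans.
  apply: (@transport_cost_le_maps _ _ _ (nu11 d eps) two_points turn) => //.
  - exact: measurable_two_points.
  - exact: measurable_turn.
  - by move=> A mA; exact: nu11_turn.
apply: (ge0_integral_le_cst (measurable_two_discs _ _ _) (nu11_support d e0)).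
- exact: measurable_sqdist measurable_two_points (@measurable_turn R).
- by move=> x; exact: sqdist_ge0.
- by have := sqr_ge0 (c - d); have := mulr_gt0 c0 e0; have := sqr_ge0 (d + eps); move: (c0) (e0) (d0); nra.
- move=> y /(two_discs_bounds e0 d0)[]; rewrite sqnormE /two_points /sqdist /turn /=.
  move=> h1 h2 h3 h5; have c0' := c0.
  have h4 := ler_norm y.2; have h6 := lerNnormlW (lexx `|y.2|).
  by case: (ger0P y.1) h1 h2 => y0 /= h1 h2; nra.
Qed.

(** On the support of the competitor, [x.y] is [c (y1 + y2)] up to sign, hence at most
    [c |y1 + y2|], and [|x|^2 = 2 c^2]. *)
Lemma competitor_nu0_ge (N m : R) :
  (\int[nu0 R]_y (sqnorm y)%:E = N%:E)%E ->
  (\int[nu0 R]_y (`|y.1 + y.2|)%:E = m%:E)%E ->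
  2 * c ^+ 2 + N - 2 * c * m <= W2 competitor (nu0 R) ^+ 2.
Proof.
move=> EN Em; have c0' := c0; have c20 : 0 <= 2 * c by lra.
rewrite (_ : _ - _ = 2 * c ^+ 2 + N - 0 - (2 * c * m + 0 * m)); last by ring.
apply: (@W2_dual_ge _ _ _ Sc setT (fun=> 0) (fun=> 2 * c ^+ 2)
  (@sqnorm R) (fun y => 2 * c * `|y.1 + y.2| + 0 * `|y.1 + y.2|)) => //.
- by rewrite setCT measure0.
- exact: measurable_sqnorm.
- exact: measurable_lin2 (@measurable_abs_sum R) (@measurable_abs_sum R).
- by move=> x; rewrite mulr_ge0// sqr_ge0.
- exact: sqnorm_ge0.
- by move=> y; rewrite mul0r addr0 mulr_ge0.
- move=> x y Sx _; rewrite mul0r sqnormE /sqdist !addr0.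
  have h1 := ler_norm (y.1 + y.2); have h2 := lerNnormlW (lexx `|y.1 + y.2|).
  by case: Sx => [] [/= -> ->]; nra.
- exact: competitor_finite_second_moment.
- exact: nu0_finite_second_moment.
- exact: integral_cst_probability.
- exact: integral_cst_probability.
- rewrite (integral_lin2 (nu0 R) (@measurable_abs_sum R) (@measurable_abs_sum R)
    (fun=> normr_ge0 _) (fun=> normr_ge0 _) c20 (lexx 0)).
  by rewrite Em -!EFinM -EFinD.
Qed.

End competitor.

End functional_bounds.

(** * Minimizers *)

Section minimizers.
Context (R : realType).
Implicit Types (mu nu : probability (plane R) R) (A : set (plane R)).

Lemma invariant_underP mu :
  invariant_under (rotation (pi / 2)) mu <-> turn_invariant mu.
Proof. by rewrite rotation_pihalf. Qed.

(* Up to constants, the functional is at least [M / 2 - B * (a1 + a2)] at an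
   invariant measure and at most [c ^+ 2 - 2 * A * c] at the competitor carried
   by [(c, c)] and [(- c, - c)]; the latter is used with [c = A]. *)
Lemma competitor_value_lt (t d eps N k m M a1 a2 X0 X1 X2 Y0 Y1 Y2 : R) :
  let A := (t * (d - 2 * eps) - (t - 1) * m) / 2 in
  let B := t / 2 * (d + 2 * eps) - (t - 1) * k in
  2 <= t -> 4 * k <= d -> 0 < eps -> 17 * eps <= k - m / 2 -> 0 <= m < 2 * k ->
  2 * B * a1 + 2 * B * a2 <= M + 2 * B ^+ 2 ->
  M + (d - eps) ^+ 2 - (2 * (d + eps) * a1 + 2 * eps * a2) <= X1 ->
  M + (d - eps) ^+ 2 - (2 * (d + eps) * a2 + 2 * eps * a1) <= X2 ->
  X0 <= M + N - 2 * (a1 * k + a2 * k) ->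
  2 * A ^+ 2 + N - 2 * A * m <= Y0 ->
  Y1 <= 2 * A ^+ 2 - 2 * A * (d - 2 * eps) + (d + eps) ^+ 2 ->
  Y2 <= 2 * A ^+ 2 - 2 * A * (d - 2 * eps) + (d + eps) ^+ 2 ->
  t * (2^-1 * (Y1 / 2) + 2^-1 * (Y2 / 2)) - (t - 1) * (Y0 / 2) <
  t * (2^-1 * (X1 / 2) + 2^-1 * (X2 / 2)) - (t - 1) * (X0 / 2).
Proof.
move=> A B t2 kd e0 de /andP[m0 mk] HM HX1 HX2 HX0 HY0 HY1 HY2.
have t0 : 0 <= t by lra.
have t1 : 0 <= t - 1 by lra.
have EA : 2 * A = t * (d - 2 * eps) - (t - 1) * m by rewrite /A; field.
have EB : 2 * B = t * (d + 2 * eps) - 2 * (t - 1) * k by rewrite /B; field.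
clearbody A B.
(* The weights [t] and [t - 1] leave [M / 2 - B * (a1 + a2)], which is at least [- B ^+ 2] by
   [HM]. *)
have lowX : - B ^+ 2 + t / 2 * (d - eps) ^+ 2 - (t - 1) * N / 2 <=
    t * (2^-1 * (X1 / 2) + 2^-1 * (X2 / 2)) - (t - 1) * (X0 / 2).
  have := ler_wpM2l t0 (lerD HX1 HX2).
  have := ler_wpM2l t1 HX0.
  have : (a1 + a2) * (2 * B) = (a1 + a2) * (t * (d + 2 * eps) - 2 * (t - 1) * k).
    by rewrite EB.
  move: HM; clear; nra.
(* With [c = A], the terms in [c] add up to [A ^+ 2 - 2 * A * A]. *)
have uppY : t * (2^-1 * (Y1 / 2) + 2^-1 * (Y2 / 2)) - (t - 1) * (Y0 / 2) <=
    - A ^+ 2 + t / 2 * (d + eps) ^+ 2 - (t - 1) * N / 2.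
  have := ler_wpM2l t0 (lerD HY1 HY2).
  have := ler_wpM2l t1 HY0.
  have : A * (2 * A) = A * (t * (d - 2 * eps) - (t - 1) * m) by rewrite EA.
  clear; nra.
(* What remains is [A ^+ 2 - B ^+ 2 > 2 * t * d * eps], the right side being the difference of the
   two terms in [(d + eps) ^+ 2] and [(d - eps) ^+ 2]. The left side is factored as
   [(A - B) * (A + B)]. *)
apply: (le_lt_trans uppY); apply: lt_le_trans lowX.
set D := k - m / 2 in de.
have D0 : 0 < D by rewrite /D; lra.
(* Here [t - 1 >= t / 2], and [2 * t * eps] is at most [2 / 17] of [t * D]. *)
have AB1 : t * D / 4 <= A - B.
  have : A - B = (t - 1) * D - 2 * t * eps by rewrite /D; lra.
  move=> ->; have := ler_wpM2l t0 de; have : t * D <= 2 * ((t - 1) * D) by nra.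
  move: (mulr_ge0 t0 (ltW D0)); clear; lra.
(* [A + B = t * d - (t - 1) * (k + m / 2)], where [k + m / 2 < 2 * k <= d / 2]. *)
have AB2 : t * d / 2 <= A + B.
  have tk : t * (4 * k) <= t * d by exact: ler_wpM2l.
  have tm : (t - 1) * m <= t * (2 * k) by nra.
  have tk' : (t - 1) * k <= t * k by nra.
  move: EA EB tk; clear - tm tk' t1 mk m0; nra.
have d0 : 0 < d by lra.
have tdD : 0 <= t * d / 2 by rewrite mulr_ge0// mulr_ge0// ltW.
have tD : 0 <= t * D / 4 by rewrite mulr_ge0// mulr_ge0// ltW.
have P := ler_pM tD tdD AB1 AB2.
have td : 0 < t * d by rewrite mulr_gt0//; lra.
have Q : t * d * (17 * eps) <= t * d * D by rewrite ler_wpM2l// ltW.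
(* With [t >= 2], the product of the two bounds is at least [t * d * D / 4], hence at least
   [17 / 4 * t * d * eps]. *)
have Q' : t * d * D * 2 <= t * d * D * t.
  by rewrite ler_wpM2l// mulr_ge0// ltW.
have Q'' : 0 < t * d * eps by rewrite mulr_gt0.
move: P Q Q' Q''; clear; nra.
Qed.

(** The sum has mass 2, so normalising it halves it; the last argument is a default value that is
    not reached. *)
Definition average mu nu : probability (plane R) R :=
  mnormalize (measure_add mu nu) mu.

Lemma averageE mu nu A :
  (average mu nu A = (2^-1)%:E * mu A + (2^-1)%:E * nu A)%E.
Proof.
have E : (measure_add mu nu [set: plane R] = 2%:E)%E.
  transitivity (mu [set: plane R] + nu [set: plane R])%E; first exact: measure_addE.
  by rewrite !probability_setT -EFinD.
transitivity (if (measure_add mu nu [set: plane R] == 0%E) ||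
    (measure_add mu nu [set: plane R] == +oo%E) then mu A
  else (measure_add mu nu A * (fine (measure_add mu nu [set: plane R]))^-1%:E)%E).
  exact: mnormalizeE.
rewrite E ifF; last by rewrite orbF eqe pnatr_eq0.
transitivity ((mu A + nu A) * (2^-1)%:E)%E; last by rewrite muleC ge0_muleDr.
by congr (_ * _)%E; exact: measure_addE.
Qed.

(** [turn] preserves [nu] and exchanges [nu1] and [nu2], which have equal weights. *)
Lemma barycenter_functional_turn (t : R) nu nu1 nu2 mu mu' :
  turn_invariant nu ->
  (forall A, measurable A -> nu1 (turn @^-1` A) = nu2 A) ->
  (forall A, measurable A -> nu2 (turn @^-1` A) = nu1 A) ->
  (forall A, measurable A -> mu (turn @^-1` A) = mu' A) ->
  barycenter_functional t nu nu1 nu2 mu' = barycenter_functional t nu nu1 nu2 mu.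
Proof.
move=> h0 h12 h21 h; rewrite /barycenter_functional.
rewrite (W2_turn h h0) (W2_turn h h12) (W2_turn h h21).
by congr (t * _ - _); rewrite addrC.
Qed.

Lemma minimizers_turn (t d eps : R) mu :
  minimizers t (nu0 R) (nu11 d eps) (nu12 d eps) mu ->
  minimizers t (nu0 R) (nu11 d eps) (nu12 d eps) (law mu (@measurable_turn R)).
Proof.
have h A : measurable A -> mu (turn @^-1` A) = law mu (@measurable_turn R) A by [].
have E := barycenter_functional_turn t (@nu0_turn R) (@nu11_turn R d eps)
  (@nu12_turn R d eps) h.
move=> [fmu min]; split; first exact: finite_second_moment_turn h fmu.
by move=> mu' fmu'; rewrite E; exact: min.
Qed.

(** Two midpoints average the orbit of order four: [sigma] is invariant under the half turn, so
    [turn] exchanges [sigma] and [tn sigma]. *)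
Lemma average_turn_invariant mu :
  let tn nu := law nu (@measurable_turn R) in
  let sigma := average mu (tn (tn mu)) in
  turn_invariant (average sigma (tn sigma)).
Proof.
move=> tn sigma A mA.
have tnE nu B : tn nu B = nu (turn @^-1` B) by [].
have sigma2 : sigma (turn @^-1` (turn @^-1` A)) = sigma A.
  rewrite /sigma !averageE addeC; congr (_ * _ + _ * _)%E.
  rewrite 2!tnE; congr (mu _).
  by apply/seteqP; split=> x; rewrite /preimage /= turn4.
by rewrite !(averageE sigma (tn sigma)) 2!(tnE sigma) sigma2 addeC.
Qed.

Lemma not_minimizer_turn_invariant (N k m t d eps : R) mu :
  (\int[nu0 R]_y (sqnorm y)%:E = N%:E)%E ->
  (\int[nu0 R]_y (`|y.1|)%:E = k%:E)%E -> (\int[nu0 R]_y (`|y.2|)%:E = k%:E)%E ->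
  (\int[nu0 R]_y (`|y.1 + y.2|)%:E = m%:E)%E -> 0 <= m < 2 * k ->
  2 <= t -> 4 * k <= d -> 0 < eps -> 17 * eps <= k - m / 2 ->
  minimizers t (nu0 R) (nu11 d eps) (nu12 d eps) mu -> ~ turn_invariant mu.
Proof.
move=> EN Ek1 Ek2 Em mk t2 kd e0 de [fmu min] hmu.
have [M [a1 [a2 [EM E1 E2]]]] := finite_second_momentP fmu.
pose A := (t * (d - 2 * eps) - (t - 1) * m) / 2.
pose B := t / 2 * (d + 2 * eps) - (t - 1) * k.
have /andP[m0 mk'] := mk.
have ed : eps <= d by lra.
(* [B] is the parameter [s] of [second_moment_ge], which must be nonnegative; [A] is the parameter
   [c] of the competitor, which must be positive. *)
have B0 : 0 <= B.
  have : t * (4 * k) <= t * d by rewrite ler_wpM2l//; lra.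
  rewrite /B; have : 0 <= t * eps by rewrite mulr_ge0//; lra.
  nra.
have A0 : 0 < A.
  have : t * (4 * k) <= t * d by rewrite ler_wpM2l//; lra.
  have : t * (17 * eps) <= t * (k - m / 2) by rewrite ler_wpM2l//; lra.
  have : 0 < t * (k - m / 2) by rewrite mulr_gt0//; lra.
  have : 0 < t * k by rewrite mulr_gt0//; lra.
  rewrite /A; nra.
have := min _ (competitor_finite_second_moment d eps A).
apply/negP; rewrite -ltNge /barycenter_functional.
have X0 := W2_turn_invariant_le hmu (@nu0_turn R) (@nu0_mirror R) EM EN E1 E2 Ek1 Ek2.
exact: (competitor_value_lt t2 kd e0 de mk (second_moment_ge B0 EM E1 E2)
  (W2_nu11_ge e0 ed fmu EM E1 E2) (W2_nu12_ge e0 ed fmu EM E1 E2) X0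
  (competitor_nu0_ge d eps A0 EN Em) (competitor_nu11_le e0 ed A0)
  (competitor_nu12_le e0 ed A0)).
Qed.

End minimizers.

Theorem mainTheorem5 (R : realType) :
  exists t0 d0 eps0 : R, 0 < eps0 /\
  forall t d eps : R,
    1 < d -> 0 < eps < 2^-1 ->
    t0 <= t -> d0 <= d -> eps <= eps0 ->
    let M := minimizers t (nu0 R) (nu11 d eps) (nu12 d eps) in
    [/\ (forall mu : probability (plane R) R,
           M mu -> ~ invariant_under (rotation (pi / 2)) mu),
        (* The existence of a minimizer is a known fact. *)
        (M !=set0 ->
           (exists mu1 mu2 : probability (plane R) R,
              [/\ M mu1, M mu2 & ~ same_measure mu1 mu2]) /\
           ~ convex_measures M) &
        [/\ nu0 R `<< area R, nu11 d eps `<< area R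
          & nu12 d eps `<< area R]].
Proof.
have [N [k [m [EN Ek1 Ek2 Em mk]]]] := nu0_moments R.
have /andP[m0 mk'] := mk.
(* These thresholds give [t - 1 >= t / 2], [A + B >= t * d / 2] and [17 * eps <= k - m / 2]; the
   last one is positive because [m < 2 * k]. *)
exists 2, (4 * k), ((k - m / 2) / 17); split; first lra.
move=> t d eps d1 /andP[e0 e1] t2 kd e2 M.
have de : 17 * eps <= k - m / 2 by lra.
have noinv mu : M mu -> ~ turn_invariant mu.
  exact: (not_minimizer_turn_invariant EN Ek1 Ek2 Em mk t2 kd e0 de).
split.
- by move=> mu Mmu /invariant_underP; exact: noinv.
- move=> [mu Mmu]; split.
    (* If a minimizer were the same measure as its rotated copy, it would be invariant. *)
    exists (law mu (@measurable_turn R)), mu; split => //.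
    + exact: minimizers_turn.
    + exact: noinv.
  move=> cvx.
  have avg mu1 mu2 : M mu1 -> M mu2 -> M (average mu1 mu2).
    move=> M1 M2; apply: (cvx _ _ _ M1 M2 2^-1).
      by apply/andP; split; lra.
    move=> A mA; rewrite averageE.
    by have -> : 1 - 2^-1 = 2^-1 :> R by field.
  have Msigma := avg _ _ Mmu (minimizers_turn (minimizers_turn Mmu)).
  exact: noinv (avg _ _ Msigma (minimizers_turn Msigma)) (average_turn_invariant _).
- have /andP[p0 q0] := area_four_discs R.
  have /andP[p1 q1] := area_two_discs (d, 0) (- d, 0) e0.
  have /andP[p2 q2] := area_two_discs (0, d) (0, - d) e0.
  split.
  + exact: (uniform_dominated (@measurable_four_discs R) p0 q0).
  + exact: (uniform_dominated (measurable_two_discs (d, 0) (- d, 0) eps) p1 q1).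
  + exact: (uniform_dominated (measurable_two_discs (0, d) (0, - d) eps) p2 q2).
Qed.
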